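(* Let $\mathcal A$ be an algebra over $\mathbb C$ with two linear functionals $\varphi,\psi:\mathcal A\to\mathbb C$. Let $K_\pi^{\mathrm{CM}}$ be the $\pi$-cumulant associated with the c-monotone spreadability system for $(\mathcal A,\varphi)$ (constructed from $\varphi,\psi$), and $K_n^{\mathrm M,\psi}$ the $n$th monotone cumulant functional with respect to $\psi$. Then for $n\in\mathbb N$, $\pi\in\mathcal{OP}_n$ and $X_1,\dots,X_n\in\mathcal A$, $$K_\pi^{\mathrm{CM}}(X_1,\dots,X_n)=\begin{cases}\displaystyle\prod_{P\in\mathrm{Outer}(\pi)}K^{\mathrm{CM}}_{|P|}(X_P)\prod_{P\in\mathrm{Inner}(\pi)}K^{\mathrm M,\psi}_{|P|}(X_P),&\pi\in\mathcal M_n,\\0,&\pi\notin\mathcal M_n.\end{cases}$$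
   Context: Ordered set partitions. $\mathbb N=\{1,2,\dots\}$, $[n]=\{1,\dots,n\}$. An ordered set partition of $[n]$ is a sequence $\pi=(P_1,\dots,P_p)$ of pairwise disjoint nonempty blocks with union $[n]$; $\mathcal{OP}_n$ is the set of them; $\pi(i)$ is the index $k$ with $i\in P_k$; $\hat1_n=([n])$. The quasi-meet is $\pi\curlywedge\sigma=(P_1\cap S_1,P_1\cap S_2,\dots,P_1\cap S_s,P_2\cap S_1,\dots,P_p\cap S_s)$ (empty sets removed) for $\sigma=(S_1,\dots,S_s)$. The ordered kernel $\kappa(i_1,\dots,i_n)$ has as blocks the level sets $\{k:i_k=v\}$ listed in increasing order of $v$. $\pi$ is noncrossing if there are no $i<j<k<l$ with $i,k$ in one block and $j,l$ in a different block. Two blocks $B,B'$ of a noncrossing $\pi$ form a nesting with outer block $B$ and inner block $B'$ if there are $i,j\in B$ with $i<k<j$ for all $k\in B'$. $\mathrm{Inner}(\pi)$ is the set of blocks of $\pi$ that are the inner block of some nesting, $\mathrm{Outer}(\pi)$ the set of the remaining blocks. $\mathcal M_n$ (monotone partitions) is the set of noncrossing $\pi\in\mathcal{OP}_n$ such that in every nesting the outer block precedes the inner block in the order of $\pi$. Spreadability systems and cumulants. For a linear functional $\varphi$ on an algebra $\mathcal A$, a spreadability system for $(\mathcal A,\varphi)$ is a triple $(\mathcal U,\tilde\varphi,(\iota^{(i)})_{i\ge1})$ with $\mathcal U$ an algebra, $\tilde\varphi:\mathcal U\to\mathbb C$ linear, $\iota^{(i)}:\mathcal A\to\mathcal U$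 homomorphisms with $\tilde\varphi\circ\iota^{(i)}=\varphi$ such that, with $X^{(i)}=\iota^{(i)}(X)$, the value $\tilde\varphi(X_1^{(i_1)}\cdots X_n^{(i_n)})$ depends on $(i_1,\dots,i_n)$ only through $\pi=\kappa(i_1,\dots,i_n)$; this value is denoted $\varphi_\pi(X_1,\dots,X_n)$. Put $\varphi_\pi(M_1.X_1,\dots,M_n.X_n)=\sum_{i_1=1}^{M_1}\cdots\sum_{i_n=1}^{M_n}\varphi_{\pi\curlywedge\kappa(i_1,\dots,i_n)}(X_1,\dots,X_n)$. For $\pi$ with $p$ blocks, $\varphi_\pi(N_{\pi(1)}.X_1,\dots,N_{\pi(n)}.X_n)$ is a polynomial in $N_1,\dots,N_p$; the cumulant $K_\pi(X_1,\dots,X_n)$ is its coefficient of $N_1\cdots N_p$. $K_n=K_{\hat1_n}$, and $K_{|P|}(X_P):=K_k(X_{p_1},\dots,X_{p_k})$ for $P=\{p_1<\dots<p_k\}$. The systems. $\mathcal U$ is the nonunital free product (coproduct of algebras) of countably many copies of $\mathcal A$, $\iota^{(i)}$ the embedding as $i$th copy. Monotone system for $(\mathcal A,\psi)$: $\tilde\psi$ on $\mathcal U$ is determined by: (a) $\tilde\psi(X_1^{(i_1)})=\psi(X_1)$; (b) for $n\ge2$, $i_1>i_2$: $\tilde\psi(X_1^{(i_1)}\cdots X_n^{(i_n)})=\psi(X_1)\tilde\psi(X_2^{(i_2)}\cdots X_n^{(i_n)})$; (c) for $n\ge2$, $i_n>i_{n-1}$: $\tilde\psi(X_1^{(i_1)}\cdots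 X_n^{(i_n)})=\tilde\psi(X_1^{(i_1)}\cdots X_{n-1}^{(i_{n-1})})\psi(X_n)$; (d) for $n\ge3$, $2\le j\le n-1$, $i_{j-1}<i_j>i_{j+1}$: $\tilde\psi(X_1^{(i_1)}\cdots X_n^{(i_n)})=\tilde\psi(X_1^{(i_1)}\cdots X_{j-1}^{(i_{j-1})}X_{j+1}^{(i_{j+1})}\cdots X_n^{(i_n)})\psi(X_j)$. Its cumulants are denoted $K^{\mathrm M,\psi}$. C-monotone system for $(\mathcal A,\varphi)$: $(\mathcal U,\tilde\varphi,(\iota^{(i)})_{i\ge1})$ where $\tilde\varphi$ is determined by rules (a), (b), (c) with $\varphi,\tilde\varphi$ in place of $\psi,\tilde\psi$, and, for $n\ge3$, $2\le j\le n-1$, $i_{j-1}<i_j>i_{j+1}$, $$\tilde\varphi(X_1^{(i_1)}\cdots X_n^{(i_n)})=\tilde\varphi(X_1^{(i_1)}\cdots X_{j-1}^{(i_{j-1})})(\varphi(X_j)-\psi(X_j))\tilde\varphi(X_{j+1}^{(i_{j+1})}\cdots X_n^{(i_n)})+\psi(X_j)\tilde\varphi(X_1^{(i_1)}\cdots X_{j-1}^{(i_{j-1})}X_{j+1}^{(i_{j+1})}\cdots X_n^{(i_n)}).$$ Its cumulants are denoted $K^{\mathrm{CM}}$. *)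

(* Defs.v *)
From HB Require Import structures.
From mathcomp Require Import all_boot all_order all_algebra.
From mathcomp Require Import boolp reals complex.
From mathcomp Require classical_sets.
From mathcomp Require Import mpoly.

Set Implicit Arguments.
Unset Strict Implicit.
Unset Printing Implicit Defensive.

Import GRing.Theory.
Local Open Scope ring_scope.

Reserved Notation "x ** y" (at level 40, left associativity).

(* The free product below is a coproduct of nonunital algebras, so neither
   algebras nor homomorphisms are required to be unital; the algTypes of the
   library always have a unit. *)
HB.mixin Record Lmodule_isNUAlgebra (K : fieldType) V of GRing.Lmodule K V := {
  numul : V -> V -> V;
  numulA : associative numul;
  numulDl : left_distributive numul +%R;
  numulDr : right_distributive numul +%R;
  nuscaleAl : forall (a : K) (x y : V), a *: numul x y = numul (a *: x) y;
  nuscaleAr : forall (a : K) (x y : V), a *: numul x y = numul x (a *: y)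
}.

#[short(type="nuAlgType")]
HB.structure Definition NUAlgebra (K : fieldType) :=
  {V of Lmodule_isNUAlgebra K V & GRing.Lmodule K V}.

Notation "x ** y" := (numul x y) : ring_scope.

Record nuhom (K : fieldType) (A B : nuAlgType K) := NUHom {
  nuhom_linear :> {linear A -> B};
  nuhomM : {morph nuhom_linear : x y / x ** y}
}.

(* Without a unit there is no empty product; the value 0 at [::] is junk. *)
Definition nuprod (K : fieldType) (U : nuAlgType K) (s : seq U) : U :=
  if s is x :: s' then foldl numul x s' else 0.

Definition is_coproduct (K : fieldType) (A U : nuAlgType K)
    (iota : nat -> nuhom A U) : Prop :=
  forall (V : nuAlgType K) (f : nat -> nuhom A V),
    (exists g : nuhom U V, forall i, g \o iota i =1 f i) /\
    (forall g h : nuhom U V,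
       (forall i, g \o iota i =1 h \o iota i) -> g =1 h).

Definition is_osp (n : nat) (s : seq {set 'I_n}) : bool :=
  [&& pairwise (fun A B : {set 'I_n} => [disjoint A & B]) s, set0 \notin s
    & \bigcup_(B <- s) B == [set: 'I_n]].

Record osp (n : nat) := OSP {
  blocks :> seq {set 'I_n};
  ospP : is_osp blocks
}.

HB.instance Definition _ n := [isSub for @blocks n].
HB.instance Definition _ n := [Equality of osp n by <:].

Section OrderedSetPartitions.

Variable n : nat.
Implicit Types (p s : osp n) (A B : {set 'I_n}) (t : seq {set 'I_n}).

Definition rm_empty t : seq {set 'I_n} := [seq B <- t | B != set0].

Lemma mem_bigcup_seq t i : (i \in \bigcup_(B <- t) B) = has (fun B => i \in B) t.
Proof. by elim: t => [|B t IHt]; rewrite ?big_nil ?big_cons !inE ?IHt. Qed.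

Lemma is_osp_rm_empty t :
  pairwise (fun A B => [disjoint A & B]) t ->
  (forall i : 'I_n, has (fun B => i \in B) t) -> is_osp (rm_empty t).
Proof.
move=> dt ct; apply/and3P; split.
- exact: subseq_pairwise (filter_subseq _ _) dt.
- by rewrite mem_filter eqxx.
apply/eqP/setP=> i; rewrite inE mem_bigcup_seq; have /hasP[B Bt iB] := ct i.
apply/hasP; exists B => //.
by rewrite mem_filter Bt andbT; apply/set0Pn; exists i.
Qed.

Lemma osp_has p i : has (fun B => i \in B) p.
Proof.
have /and3P[_ _ /eqP/setP/(_ i)] := ospP p.
by rewrite inE mem_bigcup_seq.
Qed.

Lemma osp_pos_subproof p i : (find (fun B => i \in B) p < size p)%N.
Proof. by rewrite -has_find osp_has. Qed.

(* The index pi(i) of the block containing i, counted from 0. *)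
Definition osp_pos p (i : 'I_n) : 'I_(size p) := Ordinal (osp_pos_subproof p i).

Lemma osp1_subproof : is_osp (rm_empty [:: [set: 'I_n]]).
Proof. by apply: is_osp_rm_empty => //= i; rewrite inE. Qed.

(* For n = 0 this is the empty partition. *)
Definition osp1 : osp n := OSP osp1_subproof.

Lemma quasi_meet_subproof p s :
  is_osp (rm_empty [seq A :&: B | A <- p, B <- s]).
Proof.
have dI A1 A2 B1 B2 : [disjoint A1 & A2] || [disjoint B1 & B2] ->
    [disjoint A1 :&: B1 & A2 :&: B2].
  rewrite -!setI_eq0 => dAB; rewrite setIACA.
  by case/orP: dAB => /eqP->; rewrite ?set0I ?setI0.
apply: is_osp_rm_empty => [|i]; last first.
  have /hasP[A Ap iA] := osp_has p i; have /hasP[B Bs iB] := osp_has s i.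
  by apply/hasP; exists (A :&: B); rewrite ?inE ?iA ?iB //; apply: allpairs_f.
have /and3P[dp _ _] := ospP p; have /and3P[ds _ _] := ospP s.
elim: (blocks p) dp => //= A t IHt /andP[/allP dA dt].
rewrite pairwise_cat IHt // andbT; apply/andP; split.
  apply/allrelP => _ _ /mapP[B _ ->] /allpairsP[[A' B'] [/= /dA dAA' _ ->]].
  by apply: dI; rewrite dAA'.
rewrite pairwise_map; apply: sub_pairwise ds => B B' dBB'.
by apply: dI; rewrite dBB' orbT.
Qed.

Definition quasi_meet p s : osp n := OSP (quasi_meet_subproof p s).

Definition level_sets (i : 'I_n -> nat) : seq {set 'I_n} :=
  [seq [set k | i k == v] | v <- sort leq (undup (codom i))].

Lemma kernel_subproof (i : 'I_n -> nat) : is_osp (level_sets i).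
Proof.
have mem_lv v : (v \in sort leq (undup (codom i))) = (v \in codom i).
  by rewrite mem_sort mem_undup.
apply/and3P; split.
- rewrite pairwise_map.
  have : pairwise [rel v w | v != w] (sort leq (undup (codom i))).
    by rewrite -uniq_pairwise sort_uniq undup_uniq.
  apply: sub_pairwise => v w /= vw.
  rewrite -setI_eq0; apply/eqP/setP => k; rewrite !inE.
  by case: eqP => //= ->; apply: negbTE.
- apply/negP => /mapP[v]; rewrite mem_lv => /codomP[k ->] /setP/(_ k).
  by rewrite !inE eqxx.
apply/eqP/setP => k; rewrite inE mem_bigcup_seq; apply/hasP.
exists [set l | i l == i k]; last by rewrite inE eqxx.
by apply/mapP; exists (i k); rewrite ?mem_lv ?codom_f.
Qed.

Definition kernel (i : 'I_n -> nat) : osp n := OSP (kernel_subproof i).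

Lemma mem_nth_osp p (v : 'I_(size p)) k :
  (k \in nth set0 p v) = (osp_pos p k == v).
Proof.
apply/idP/eqP => [kv | <-]; last exact: (nth_find set0 (osp_has p k)).
apply: val_inj; apply/eqP; rewrite /= eqn_leq leqNgt; apply/andP; split.
  by apply/negP => /(before_find set0); rewrite kv.
rewrite leqNgt; apply/negP => ltv.
have /and3P[/(pairwiseP set0) dp _ _] := ospP p.
have /pred0P/(_ k) /= := dp _ _ (osp_pos_subproof p k) (ltn_ord v) ltv.
by rewrite kv (nth_find set0 (osp_has p k)).
Qed.

Lemma kernel_osp_pos p : kernel (fun k => osp_pos p k) = p.
Proof.
have dom : sort leq (undup (codom (fun k => osp_pos p k : nat))) =
    iota 0 (size p).
  apply: (sorted_eq leq_trans anti_leq);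
    rewrite ?iota_sorted ?sort_sorted //; try exact: leq_total.
  rewrite perm_sort; apply: uniq_perm; rewrite ?undup_uniq ?iota_uniq // => v.
  rewrite mem_undup mem_iota /= add0n; apply/codomP/idP => [[k ->] | vp].
    exact: (osp_pos_subproof p k).
  have /and3P[_ p0 _] := ospP p.
  have /set0Pn[k kv] : nth set0 p v != set0.
    by apply: contraNneq p0 => <-; apply: mem_nth.
  exists k; move: kv; rewrite (mem_nth_osp (Ordinal vp)).
  by move=> /eqP/(congr1 val)/esym.
apply: val_inj; rewrite /= /level_sets dom.
apply: (@eq_from_nth _ set0); rewrite size_map size_iota // => v vp.
rewrite (nth_map 0%N) ?size_iota // nth_iota // add0n; apply/setP => k.
by rewrite inE (mem_nth_osp (Ordinal vp)).
Qed.

Definition noncrossing p : bool :=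
  all (fun A => all (fun B => (A != B) ==>
    ~~ [exists i in A, exists j in B, exists k in A, exists l in B,
          [&& (i < j)%N, (j < k)%N & (k < l)%N]]) p) p.

(* A is the outer block and B the inner block. *)
Definition nesting A B : bool :=
  [exists i in A, exists j in A, forall k in B, (i < k)%N && (k < j)%N].

Definition inner p : seq {set 'I_n} :=
  [seq B <- p | has (fun A => nesting A B) p].

Definition outer p : seq {set 'I_n} := [seq B <- p | B \notin inner p].

Definition monotone_osp p : bool :=
  noncrossing p &&
  all (fun A => all (fun B => nesting A B ==> (index A p < index B p)%N) p) p.

End OrderedSetPartitions.

Arguments osp1 n : clear implicits.

(* The word [:: (i_1, X_1); ...; (i_n, X_n)] stands for
   X_1^(i_1) ... X_n^(i_n). *)
Definition eval_word (K : fieldType) (A U : nuAlgType K) (tphi : {scalar U})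
    (iota : nat -> nuhom A U) (w : seq (nat * A)) : K :=
  tphi (nuprod [seq iota x.1 x.2 | x <- w]).

Definition word (T : Type) (n : nat) (i : 'I_n -> nat) (X : 'I_n -> T) :
    seq (nat * T) :=
  [seq (i k, X k) | k <- enum 'I_n].

(* The copies of A are indexed from 0: only the order of the indices
   matters. *)
Record spread_system (K : fieldType) (A : nuAlgType K) (phi : {scalar A}) :=
  SpreadSystem {
    sp_alg : nuAlgType K;
    sp_tphi : {scalar sp_alg};
    sp_iota : nat -> nuhom A sp_alg;
    sp_tphi_iota : forall i, sp_tphi \o sp_iota i =1 phi;
    sp_spread : forall (n : nat) (i j : 'I_n -> nat) (X : 'I_n -> A),
      kernel i = kernel j ->
      eval_word sp_tphi sp_iota (word i X) = eval_word sp_tphi sp_iota (word j X)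
  }.

Definition sp_eval (K : fieldType) (A : nuAlgType K) (phi : {scalar A})
    (S : spread_system phi) (w : seq (nat * A)) : K :=
  eval_word (@sp_tphi _ _ _ S) (@sp_iota _ _ _ S) w.

Section Cumulants.

Variables (K : fieldType) (A : nuAlgType K) (phi : {scalar A}).
Variables (S : spread_system phi).

(* The indices pi(1), ..., pi(n) have ordered kernel pi, see kernel_osp_pos;
   by spreadability, any other such indices give the same value, see
   phi_part_kernel. *)
Definition phi_part (n : nat) (p : osp n) (X : 'I_n -> A) : K :=
  sp_eval S (word (fun k => osp_pos p k) X).

Lemma phi_part_kernel (n : nat) (i : 'I_n -> nat) (X : 'I_n -> A) :
  phi_part (kernel i) X = sp_eval S (word i X).
Proof. by apply: sp_spread; rewrite kernel_osp_pos. Qed.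

Definition phi_dot (n : nat) (p : osp n) (M : 'I_n -> nat) (X : 'I_n -> A) : K :=
  \sum_(i : {dffun forall k : 'I_n, 'I_(M k)})
    phi_part (quasi_meet p (kernel (fun k => i k))) X.

Definition is_phi_dot_poly (n : nat) (p : osp n) (X : 'I_n -> A)
    (P : {mpoly K[size p]}) : Prop :=
  forall N : 'I_(size p) -> nat, (forall b, (0 < N b)%N) ->
    P.@[fun b => (N b)%:R] = phi_dot p (fun k => N (osp_pos p k)) X.

Arguments is_phi_dot_poly {n} p X P.

(* The coefficient of N_1 ... N_p. In characteristic 0 there is exactly one
   polynomial as above, which xget selects. *)
Definition cumulant (n : nat) (p : osp n) (X : 'I_n -> A) : K :=
  (classical_sets.xget 0 (is_phi_dot_poly p X))@_[multinom 1%N | _ < size p].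

(* enum_val lists the elements of P in increasing order. *)
Definition block_cumulant (n : nat) (P : {set 'I_n}) (X : 'I_n -> A) : K :=
  cumulant (osp1 #|P|) (fun j => X (enum_val j)).

End Cumulants.

Section Systems.

Variables (K : fieldType) (A : nuAlgType K).
Implicit Types (phi psi : {scalar A}) (u v : seq (nat * A)).

Definition monotone_rules psi (S : spread_system psi) : Prop :=
  let E := sp_eval S in
  [/\ forall i x, E [:: (i, x)] = psi x,
      forall i1 i2 x1 x2 v, (i1 > i2)%N ->
        E [:: (i1, x1), (i2, x2) & v] = psi x1 * E ((i2, x2) :: v),
      forall i i' x x' u, (i' > i)%N ->
        E (u ++ [:: (i, x); (i', x')]) = E (u ++ [:: (i, x)]) * psi x'
    & forall i1 i2 i3 x1 x2 x3 u v, (i1 < i2)%N -> (i2 > i3)%N ->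
        E (u ++ [:: (i1, x1), (i2, x2), (i3, x3) & v]) =
        E (u ++ [:: (i1, x1), (i3, x3) & v]) * psi x2].

Definition cmonotone_rules phi psi (S : spread_system phi) : Prop :=
  let E := sp_eval S in
  [/\ forall i x, E [:: (i, x)] = phi x,
      forall i1 i2 x1 x2 v, (i1 > i2)%N ->
        E [:: (i1, x1), (i2, x2) & v] = phi x1 * E ((i2, x2) :: v),
      forall i i' x x' u, (i' > i)%N ->
        E (u ++ [:: (i, x); (i', x')]) = E (u ++ [:: (i, x)]) * phi x'
    & forall i1 i2 i3 x1 x2 x3 u v, (i1 < i2)%N -> (i2 > i3)%N ->
        E (u ++ [:: (i1, x1), (i2, x2), (i3, x3) & v]) =
        E (u ++ [:: (i1, x1)]) * (phi x2 - psi x2) * E ((i3, x3) :: v) +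
        psi x2 * E (u ++ [:: (i1, x1), (i3, x3) & v])].

(* The free product is taken up to isomorphism, i.e. as any coproduct. *)
Record monotone_system psi := MonotoneSystem {
  mono_spread :> spread_system psi;
  mono_coproduct : is_coproduct (@sp_iota _ _ _ mono_spread);
  mono_rules : monotone_rules mono_spread
}.

Record cmonotone_system phi psi := CMonotoneSystem {
  cmono_spread :> spread_system phi;
  cmono_coproduct : is_coproduct (@sp_iota _ _ _ cmono_spread);
  cmono_rules : cmonotone_rules psi cmono_spread
}.

End Systems.

(* Main.v *)
Require Import Defs.
From HB Require Import structures.
From mathcomp Require Import all_boot all_order all_algebra.
From mathcomp Require Import boolp reals complex.
From mathcomp Require classical_sets.
From mathcomp Require Import mpoly ring zify.

(** For a word of letters carrying block labels, let the block b stand for N_b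
    consecutive copies of the algebra, later blocks having larger indices, and
    replace each letter by the sum of its copies.  For the labels
    pi(1), ..., pi(n) the value F of the resulting product is the polynomial in
    the sizes N_b whose coefficient of N_1 ... N_p is the cumulant of pi
    ([phi_dotE], [cumulant_of_term]).  This coefficient is found by removing the
    blocks one at a time, the last one first.

    With value 1 on the empty word, the rules of a c-monotone system become one
    rule for a letter x whose index exceeds those of its neighbours:
      F(u x v) = F(u) (phi(x) - psi(x)) F(v) + psi(x) F(u v),
    and the monotone rules are the case phi = psi.  The same rule holds for a
    whole subword V whose indices all exceed those of its two neighbours
    ([block_peak]):
      F(u V v) = F(u) (F(V) - G(V)) F(v) + G(V) F(u v),
    where G is the monotone value.  Summing over copies, it holds when V is a
    run of the last block ([lift_sum_block]).

    Here F(V) and G(V) are polynomials in the size N_t of the last block t, by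
    spreadability: the words indexed by a given set of j copies contribute an
    amount depending on j only, so F(V) is a combination of binomial
    coefficients C(N_t, j) with j > 0.  It has no constant term, and its linear
    coefficient is K_n ([lift_sum_one_block], [cumulant_osp1]).  More generally
    the value of a word is divisible by the product of the N_b over its labels
    b; hence a product of values of two words sharing a label contributes nothing
    to the coefficient of N_1 ... N_p ([multilinear_termM]).

    Consequently a last block made of at least two runs gives the coefficient 0;
    such a partition is not monotone, because the gap between two runs contains
    an earlier block.  Suppose that the last block is one run V.  If u and v
    share a label, then V is an inner block, the first summand vanishes, and the
    second one gives the factor K^M(V).  Otherwise V is an outer block, and as
    the formula to be proved is multiplicative over words without common labels,
    the two summands combine to K^CM(V) times the coefficient for u v
    ([lift_sum_term]).

    Monotonicity and innerness are read off the word of labels: a partition is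
    monotone if and only if a <= b whenever a, b, a is a subsequence of its
    labels ([monotone_ospE]), and then b is inner if and only if a, b, a is a
    subsequence for some a different from b ([inner_blockE]). *)

Set Implicit Arguments.
Unset Strict Implicit.
Unset Printing Implicit Defensive.

Import Num.Theory GRing.Theory.
Local Open Scope ring_scope.

(** * Values of words *)

Section WordValue.

Variables (K : fieldType) (A : nuAlgType K) (phi : {scalar A}).
Variable S : spread_system phi.
Implicit Types w u v : seq (nat * A).

Lemma nuprod_merge (U : nuAlgType K) (u v : seq U) x y :
  nuprod (u ++ [:: x, y & v]) = nuprod (u ++ x ** y :: v).
Proof.
by case: u => [|a u] //=; rewrite !foldl_cat /= numulA.
Qed.

(** The value 1 at the empty word makes the rules for the first letter, for the
    last letter and for a single letter instances of the rule for an interior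
    peak. *)
Definition word_val w : K := if w is [::] then 1 else sp_eval S w.

(** Each copy is embedded by a homomorphism, so equal neighbouring indices can
    be merged; this shortens any word having no strict peak at its maximum. *)
Lemma word_val_merge u v i x y :
  word_val (u ++ [:: (i, x), (i, y) & v]) = word_val (u ++ (i, x ** y) :: v).
Proof.
have -> w z : word_val (w ++ z :: v) = sp_eval S (w ++ z :: v) by case: w.
have -> w z t : word_val (w ++ [:: z, t & v]) = sp_eval S (w ++ [:: z, t & v]).
  by case: w.
by rewrite /sp_eval /eval_word !map_cat /= nuprod_merge nuhomM.
Qed.

End WordValue.

Section PeakRule.

Variables (K : fieldType) (A : nuAlgType K) (phi psi : {scalar A}).
Variable S : spread_system phi.
Hypothesis rS : cmonotone_rules psi S.
Implicit Types w u v : seq (nat * A).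

Let E := word_val S.

(** Only the head of [w] is looked at: in a word [u ++ V ++ v] the neighbours of
    [V] are the heads of [rev u] and [v], and an absent neighbour is no
    constraint. *)
Definition below (i : nat) w := if w is x :: _ then (x.1 < i)%N else true.

Lemma peak_cmonotone u v i x : below i (rev u) -> below i v ->
  E (u ++ (i, x) :: v) = E u * (phi x - psi x) * E v + psi x * E (u ++ v).
Proof.
case: rS => ra rb rc rd; rewrite /E.
case/lastP: u => [_|u [j y]]; last rewrite rev_rcons /=.
  case: v => [|[k z] v] /= hk; first by rewrite ra; ring.
  by rewrite rb //; ring.
case: v => [|[k z] v] /= hj; last move=> hk.
  rewrite !cats0 => _; rewrite -cats1 -catA /=.
  have -> w t s : word_val S (w ++ [:: t; s]) = sp_eval S (w ++ [:: t; s]).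
    by case: w.
  have -> w t : word_val S (w ++ [:: t]) = sp_eval S (w ++ [:: t]) by case: w.
  by rewrite rc //; ring.
rewrite -!cats1 -!catA /=.
have -> w t s r : word_val S (w ++ [:: t, s & r]) = sp_eval S (w ++ [:: t, s & r]).
  by case: w.
have -> w t : word_val S (w ++ [:: t]) = sp_eval S (w ++ [:: t]) by case: w.
by rewrite rd //; case: u.
Qed.

End PeakRule.

(** The term with the factor phi - psi disappears for phi = psi, so that
    everything proved for c-monotone systems holds for monotone ones. *)
Lemma cmonotone_of_monotone (K : fieldType) (A : nuAlgType K) (psi : {scalar A})
  (S : spread_system psi) : monotone_rules S -> cmonotone_rules psi S.
Proof.
case=> ra rb rc rd; split=> // i1 i2 i3 x1 x2 x3 u v h1 h2.
by rewrite rd // subrr mulr0 mul0r add0r mulrC.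
Qed.

Section BlockRule.

Variables (K : fieldType) (A : nuAlgType K) (phi psi : {scalar A}).
Variables (S : spread_system phi) (S' : spread_system psi).
Hypothesis rS : cmonotone_rules psi S.
Hypothesis rS' : monotone_rules S'.
Implicit Types w u v : seq (nat * A).

Let E := word_val S.
Let E' := word_val S'.

(** The first occurrence of the maximal index exceeds what precedes it, and is
    at least what follows. *)
Lemma first_peak w : w != [::] ->
  exists u i x v, [/\ w = u ++ (i, x) :: v, all (fun y => y.1 < i)%N u
    & all (fun y => y.1 <= i)%N v].
Proof.
elim: w => [//|[a y] w IH] _.
case: w IH => [_|b w /(_ isT)]; first by exists [::], a, y, [::].
move=> [u [i [x [v [-> hu hv]]]]]; have [lt_ai|le_ia] := ltnP a i.
  by exists ((a, y) :: u), i, x, v; split=> //=; rewrite lt_ai.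
exists [::], a, y, (u ++ (i, x) :: v); split=> //; rewrite all_cat /= le_ia /=.
apply/andP; split; apply/allP => z zu.
  by apply: leq_trans (ltnW (allP hu _ zu)) le_ia.
exact: leq_trans (allP hv _ zu) le_ia.
Qed.

(** Induction on the length of [V]: either the first maximal letter of [V] equals
    its right neighbour, and the two merge, or it is a strict peak of [V].  In the
    second case write V = V1 x V2.  The peak rule expands the values of u V v and
    of V at x, and the induction hypothesis applies to V1 next to u alone, to V2
    next to v alone, and to V1 V2 between u and v. *)
Lemma block_peak u V v :
  all (fun y => below y.1 (rev u) && below y.1 v) V ->
  E (u ++ V ++ v) = E u * (E V - E' V) * E v + E' V * E (u ++ v).
Proof.
have [n] := ubnP (size V); elim: n u V v => // n IHn u V v ltVn hV.
have [->|V0] := eqVneq V [::].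
  by rewrite /E /E' /= subrr; ring.
have [V1 [i [x [V2 [defV hV1 hV2]]]]] := first_peak V0.
have /andP[hu hv] : below i (rev u) && below i v.
  by move/allP: hV => /(_ (i, x)); apply; rewrite defV mem_cat inE eqxx orbT.
have subV y : y \in V1 ++ V2 -> below y.1 (rev u) && below y.1 v.
  move=> yV; apply: (allP hV); rewrite defV mem_cat inE orbCA -mem_cat.
  by rewrite yV orbT.
have szV : (size V1 + size V2 < n)%N.
  by move: ltVn; rewrite defV size_cat /= addnS ltnS.
(* The right neighbour of the peak inside V has an index at most i. *)
have [V2i|nV2i] := boolP (if V2 is y :: _ then y.1 == i else false).
  case: V2 defV hV2 subV szV V2i => // -[j y] V2 -> _ /= subV szV /eqP eji.
  rewrite {j}eji in subV *.
  rewrite -!catA /= catA /E !word_val_merge /E' word_val_merge -catA.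
  rewrite -/E -/E' -(IHn u (V1 ++ (i, x ** y) :: V2)) ?catA //=.
  - by rewrite -!catA.
  - by rewrite size_cat.
  apply/allP => z; rewrite mem_cat inE; case/or3P => [zV|/eqP->|zV].
  - by apply: subV; rewrite mem_cat zV.
  - by rewrite hu hv.
  - by apply: subV; rewrite mem_cat inE zV !orbT.
have hV2' : below i V2.
  case: V2 hV2 nV2i {defV subV szV} => [|[j y] V2] //= /andP[le_ji _].
  by rewrite ltn_neqAle le_ji => ->.
have hV1' w : below i (rev w) -> below i (rev (w ++ V1)).
  case/lastP: (V1) hV1 => [|W y]; first by rewrite cats0.
  by rewrite all_rcons -rcons_cat rev_rcons /= => /andP[].
have hV2'' : below i (V2 ++ v) by case: (V2) hV2'.
have P1 := peak_cmonotone rS x (hV1' u hu) hV2''.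
have P2 := peak_cmonotone rS x (hV1' [::] isT) hV2'.
have P3 := peak_cmonotone (cmonotone_of_monotone rS') x (hV1' [::] isT) hV2'.
have I1 : E (u ++ V1 ++ [::]) =
    E u * (E V1 - E' V1) * E [::] + E' V1 * E (u ++ [::]).
  apply: IHn; first exact: leq_ltn_trans (leq_addr _ _) szV.
  apply/allP => y yV; rewrite andbT.
  by have /andP[] : below y.1 (rev u) && below y.1 v by rewrite subV // mem_cat yV.
have I2 : E ([::] ++ V2 ++ v) =
    E [::] * (E V2 - E' V2) * E v + E' V2 * E ([::] ++ v).
  apply: IHn; first exact: leq_ltn_trans (leq_addl _ _) szV.
  apply/allP => y yV /=.
  by have /andP[] : below y.1 (rev u) && below y.1 v
    by rewrite subV // mem_cat yV orbT.
have I3 : E (u ++ (V1 ++ V2) ++ v) =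
    E u * (E (V1 ++ V2) - E' (V1 ++ V2)) * E v + E' (V1 ++ V2) * E (u ++ v).
  by apply: IHn => //; [rewrite size_cat|apply/allP].
rewrite !cats0 /= in I1 I2 P1 P2 P3; rewrite -!catA in P1 I3.
rewrite -/E -/E' in P1 P2 P3; rewrite defV -catA /= P1 P2 P3 -/E -/E' I1 I2 I3.
by ring.
Qed.

End BlockRule.

(** * Polynomials in the sizes of the blocks *)

Section PolynomialIdentity.

Variables (K : numFieldType) (m : nat).
Implicit Types (P Q : {mpoly K[m]}).

Lemma poly_eq0_nat (L : idomainType) (q : {poly L}) :
  injective (fun k : nat => k%:R : L) ->
  (forall k, (0 < k)%N -> q.[k%:R] = 0) -> q = 0.
Proof.
move=> injL q0; apply: (@roots_geq_poly_eq0 _ _ [seq k%:R | k <- iota 1 (size q)]).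
- by apply/allP => _ /mapP[k + ->]; rewrite mem_iota => /andP[k0 _]; apply/rootP/q0.
- by rewrite map_inj_uniq ?iota_uniq.
- by rewrite size_map size_iota.
Qed.

Lemma rmorph_meval (L : comNzRingType) (f : {rmorphism K -> L}) v P :
  f P.@[v] = mmap f (fun b => f (v b)) P.
Proof.
rewrite /meval /mmap rmorph_sum; apply: eq_bigr => mm _. rewrite rmorphM.
by congr (_ * _); rewrite /mmap1 rmorph_prod; apply: eq_bigr => b _; rewrite rmorphXn.
Qed.

(** The variables are freed one at a time: at stage k the first k of them take
    arbitrary values in the polynomial ring itself, the others positive
    integers.  A polynomial in the variable k alone that vanishes at all positive
    integers is zero, which leads from k to k + 1.  In the end the variables may
    be evaluated at themselves. *)
Lemma mpoly_eq0_nat P :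
  (forall N : 'I_m -> nat, (forall b, (0 < N b)%N) -> P.@[fun b => (N b)%:R] = 0) ->
  P = 0.
Proof.
move=> P0; pose L := {mpoly K[m]}; pose f : {rmorphism K -> L} := @mpolyC m K.
have injL : injective (fun k : nat => k%:R : L).
  move=> k l /= /(congr1 (mcoeff 0%MM)); rewrite -!mpolyC_nat !mcoeffC eqxx !mulr1.
  by move/eqP; rewrite eqr_nat => /eqP.
(* h sends the first k variables anywhere, the others to positive integers. *)
suff mmapP0 k (h : 'I_m -> L) :
    (forall b : 'I_m, (k <= b)%N -> exists2 N, (0 < N)%N & h b = N%:R) ->
    mmap f h P = 0.
  rewrite -[P]comp_mpoly_id; apply: (mmapP0 m) => b.
  by rewrite leqNgt ltn_ord.
elim: k h => [|k IHk] h hN.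
  have /fin_all_exists2[N N0 hE] : forall b, exists2 N, (0 < N)%N & h b = N%:R.
    by move=> b; apply: hN.
  rewrite -(rmorph0 f) -(P0 N N0) rmorph_meval /mmap; apply: eq_bigr => mm _.
  by congr (_ * _); apply: eq_bigr => b _; rewrite hE (rmorph_nat f).
have [ltkm|lemk] := ltnP k m; last first.
  by apply: IHk => b lekb; have := leq_trans lemk lekb; rewrite leqNgt ltn_ord.
pose b0 := Ordinal ltkm.
(* Evaluation with the value of the variable k replaced by an indeterminate. *)
pose h' b : {poly L} := if b == b0 then 'X else (h b)%:P.
pose q := mmap (polyC \o f) h' P.
have qE x : q.[x] = mmap f (fun b => if b == b0 then x else h b) P.
  rewrite /q /mmap horner_sum; apply: eq_bigr => mm _.
  rewrite hornerCM; congr (_ * _); rewrite /mmap1 horner_prod.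
  by apply: eq_bigr => b _; rewrite horner_exp /h'; case: eqP => _; rewrite ?hornerX ?hornerC.
have q0 : q = 0.
  apply: (poly_eq0_nat injL) => N N0; rewrite qE; apply: IHk => b lekb.
  case: eqP => [_|neq]; first by exists N.
  apply: hN; rewrite ltn_neqAle lekb andbT; apply/eqP => ekb; apply: neq.
  exact: val_inj.
have := qE (h b0); rewrite q0 horner0 => ->.
rewrite /mmap; apply: eq_bigr => mm _; congr (_ * _).
by apply: eq_bigr => b _; case: eqP => [->|].
Qed.

End PolynomialIdentity.

Section LowestTerm.

Variables (K : numFieldType) (m : nat).
Implicit Types (B C : {set 'I_m}) (G H : ('I_m -> nat) -> K) (c d : K).

(** Up to the factor prod_(b in B) N_b, a polynomial is recorded through its
    cofactor [Q], whose value at 0 is the coefficient of that monomial.  [G] is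
    kept as a function of the sizes since the values of words arise as
    functions. *)
Definition multilinear_term B G c :=
  exists2 Q : {mpoly K[m]},
    forall N, G N = (\prod_(b in B) N b)%:R * Q.@[fun b => (N b)%:R] &
    Q.@[fun=> 0] = c.

Lemma multilinear_termD B G H c d : multilinear_term B G c -> multilinear_term B H d ->
  multilinear_term B (fun N => G N + H N) (c + d).
Proof.
by case=> P PG <- [Q QH <-]; exists (P + Q) => [N|]; rewrite mevalD // PG QH mulrDr.
Qed.

Lemma multilinear_termZ B G a c : multilinear_term B G c ->
  multilinear_term B (fun N => a * G N) (a * c).
Proof.
by case=> P PG <-; exists (a *: P) => [N|]; rewrite mevalZ // PG mulrCA.
Qed.

Lemma meval_prodX B (v : 'I_m -> K) :
  (\prod_(b in B) 'X_b : {mpoly K[m]}).@[v] = \prod_(b in B) v b.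
Proof.
rewrite (big_morph _ (mevalM v) (meval1 v)).
by apply: eq_bigr => b _; rewrite mevalXU.
Qed.

(** If [B] and [C] share an index b, the product is divisible by the square of
    N_b, so its multilinear part vanishes; this is what excludes nonmonotone
    partitions. *)
Lemma multilinear_termM B C G H c d : multilinear_term B G c -> multilinear_term C H d ->
  multilinear_term (B :|: C) (fun N => G N * H N)
    (if [disjoint B & C] then c * d else 0).
Proof.
case=> P PG <- [Q QH <-]; exists ((\prod_(b in B :&: C) 'X_b) * (P * Q)) => [N|].
  rewrite !mevalM PG QH meval_prodX.
  rewrite -natr_prod mulrACA -natrM [RHS]mulrA -natrM; congr (_%:R * _).
  (* Each index is counted as often in B and C as in their union and intersection. *)
  rewrite !(big_mkcond (fun b => b \in _)) -!big_split /=.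
  by apply: eq_bigr => b _; rewrite !inE; case: (b \in B); case: (b \in C); rewrite ?mul1n ?muln1.
rewrite !mevalM meval_prodX -setI_eq0; have [->|] := eqVneq (B :&: C) set0.
  by rewrite big_set0 mul1r.
by case/set0Pn=> b bBC; rewrite (bigD1 b) //= !mul0r.
Qed.

Lemma eq_multilinear_term B G H c : (forall N, G N = H N) ->
  multilinear_term B G c -> multilinear_term B H c.
Proof. by move=> GH [P PG PE]; exists P => // N; rewrite -GH. Qed.

Lemma mcoeff0_meval (P : {mpoly K[m]}) : mcoeff 0%MM P = P.@[fun=> 0].
Proof.
elim/mpolyind: P => [|c k P _ _ IHP]; first by rewrite mcoeff0 meval0.
rewrite mcoeffD mevalD IHP mcoeffZ mevalZ mcoeffX mevalX; congr (_ * _ + _).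
have [->|k0] := eqVneq k 0%MM; first by rewrite big1 // => b _; rewrite mnm0E.
have /existsP[b kb] : [exists b, k b != 0%N].
  apply: contraNT k0 => /existsPn k0; apply/eqP/mnmP => b; rewrite mnm0E.
  by apply/eqP; rewrite -[_ == _]negbK k0.
by rewrite (bigD1 b) //= expr0n (negPf kb) mul0r.
Qed.

Lemma meval_mnm1 (v : 'I_m -> K) :
  ('X_[[multinom 1%N | _ < m]] : {mpoly K[m]}).@[v] = \prod_(b in [set: 'I_m]) v b.
Proof.
rewrite mevalX; apply: eq_big => b; first by rewrite inE.
by rewrite mnmE expr1.
Qed.

(** Two polynomials with the same values at positive integers are equal, so the
    chosen one is the one given by the multilinear term. *)
Lemma xget_multilinear_term G c (D : classical_sets.set {mpoly K[m]}) :
  multilinear_term setT G c ->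
  D = (fun P : {mpoly K[m]} => forall N : 'I_m -> nat, (forall b, (0 < N b)%N) ->
    P.@[fun b => (N b)%:R] = G N) ->
  (classical_sets.xget 0 D)@_[multinom 1%N | _ < m] = c.
Proof.
case=> Q QG <- defD; pose P := Q * 'X_[[multinom 1%N | _ < m]].
have PG N : P.@[fun b => (N b)%:R] = G N.
  by rewrite QG mevalM meval_mnm1 natr_prod mulrC.
have -> : classical_sets.xget 0 D = P.
  case: classical_sets.xgetP => [P' _|/(_ P)]; rewrite defD; last by case.
  move=> P'G.
  apply/eqP; rewrite -subr_eq0; apply/eqP/mpoly_eq0_nat => N N0.
  by rewrite mevalB PG P'G // subrr.
by rewrite -[X in mcoeff X]addm0 mcoeffMX mcoeff0_meval.
Qed.

End LowestTerm.

(** * Monotone words of block labels *)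

Section Subseq.
Variable T : eqType.
Implicit Types (a b c : T) (s x y : seq T).

Lemma subseq_catP s x y : subseq s (x ++ y) ->
  exists s1 s2, [/\ s = s1 ++ s2, subseq s1 x & subseq s2 y].
Proof.
case/subseqP => k _ ->; exists (mask (take (size x) k) x), (mask (drop (size x) k) y).
rewrite !mask_subseq; split => //.
elim: x k => [|z x IHx] k; first by rewrite take0 drop0.
case: k => [|b k] /=; first by rewrite mask0s.
by rewrite IHx; case: b.
Qed.

Lemma subseq2_cat a b x y : subseq [:: a; b] (x ++ y) =
  [|| subseq [:: a; b] x, (a \in x) && (b \in y) | subseq [:: a; b] y].
Proof.
apply/idP/or3P => [/subseq_catP[s1 [s2 [+ h1 h2]]]|[h|/andP[h1 h2]|h]].
- case: s1 h1 => [|c [|d [|e s1]]] //= h1; last 1 first.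
  + by case: s2 h2 => // _ [-> ->]; constructor 1.
  + by move=> e; rewrite e; constructor 3.
  by case=> ac e; constructor 2; rewrite -!sub1seq ac e h1.
- exact: subseq_trans h (prefix_subseq _ _).
- by rewrite (@cat_subseq _ [:: a] [:: b]) // sub1seq.
- exact: subseq_trans h (suffix_subseq _ _).
Qed.

Lemma subseq3_cat a b c x y : subseq [:: a; b; c] (x ++ y) =
  [|| subseq [:: a; b; c] x, subseq [:: a; b] x && (c \in y),
      (a \in x) && subseq [:: b; c] y | subseq [:: a; b; c] y].
Proof.
apply/idP/or4P => [/subseq_catP[s1 [s2 [+ h1 h2]]]|[h|/andP[h1 h2]|/andP[h1 h2]|h]].
- case: s1 h1 => [|d [|e [|f [|g s1]]]] //= h1.
  + by move=> e; rewrite e; constructor 4.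
  + by case=> ad e; constructor 3; rewrite -sub1seq ad e h1.
  + by case=> ad be es; constructor 2; rewrite -(sub1seq c) ad be es h1.
  by case: s2 h2 => // _ [-> -> ->]; constructor 1.
- exact: subseq_trans h (prefix_subseq _ _).
- by rewrite (@cat_subseq _ [:: a; b] [:: c]) // sub1seq.
- by rewrite (@cat_subseq _ [:: a] [:: b; c]) // sub1seq.
- exact: subseq_trans h (suffix_subseq _ _).
Qed.

Lemma mem_subseq2 a b s : subseq [:: a; b] s -> (a \in s) && (b \in s).
Proof. by move/mem_subseq=> h; rewrite !h // !inE eqxx ?orbT. Qed.

Lemma mem_subseq3 a b c s : subseq [:: a; b; c] s -> [&& a \in s, b \in s & c \in s].
Proof. by move/mem_subseq=> h; rewrite !h // !inE eqxx ?orbT. Qed.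

End Subseq.

Section LabelWords.

Variable m : nat.
Implicit Types (l : seq 'I_m) (a b t : 'I_m).

(** Under noncrossing, a pattern a, b, a says that b is nested in a; a crossing
    gives both patterns a, b, a and b, a, b, which the order condition forbids. *)
Definition mono_word l := [forall a, forall b, subseq [:: a; b; a] l ==> (a <= b)%N].

Definition inner_label l b := [exists a, (a != b) && subseq [:: a; b; a] l].

Definition labels (Y : Type) (w : seq ('I_m * Y)) := [seq x.1 | x <- w].

Definition subword (Y : Type) (w : seq ('I_m * Y)) b := [seq x.2 | x <- w & x.1 == b].

Section Disjoint.
Variables lu lv : seq 'I_m.
Hypothesis duv : [disjoint [set b in lu] & [set b in lv]].

Let luF b : b \in lu -> (b \in lv) = false.
Proof.
move=> bu; have /pred0P/(_ b) /= := duv.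
by rewrite !inE bu.
Qed.

Lemma subseq_cat_disjoint a b : subseq [:: a; b; a] (lu ++ lv) =
  subseq [:: a; b; a] lu || subseq [:: a; b; a] lv.
Proof.
rewrite subseq3_cat; case: (subseq _ lu) => //=; case: (subseq [:: a; b; a] lv);
  rewrite ?orbT // !orbF.
apply/negP => /orP[/andP[/mem_subseq2/andP[/luF->]]|/andP[/luF av /mem_subseq2]] //.
by rewrite av andbF.
Qed.

Lemma mono_word_cat : mono_word (lu ++ lv) = mono_word lu && mono_word lv.
Proof.
apply/idP/andP => [/forallP h|[/forallP hu /forallP hv]].
  split; apply/forallP=> a; apply/forallP=> b; apply/implyP=> s;
    by move: (forallP (h a) b); rewrite subseq_cat_disjoint s ?orbT.
apply/forallP=> a; apply/forallP=> b; rewrite subseq_cat_disjoint.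
by apply/implyP=> /orP[] s; [move: (forallP (hu a) b)|move: (forallP (hv a) b)]; rewrite s.
Qed.

Lemma inner_label_catl b : b \in lu -> inner_label (lu ++ lv) b = inner_label lu b.
Proof.
move=> bu; apply: eq_existsb => a; congr (_ && _); rewrite subseq_cat_disjoint.
by apply/orb_idr => /mem_subseq3; rewrite (luF bu) andbF.
Qed.

Lemma inner_label_catr b : b \in lv -> inner_label (lu ++ lv) b = inner_label lv b.
Proof.
move=> bv; apply: eq_existsb => a; congr (_ && _); rewrite subseq_cat_disjoint.
by apply/orb_idl => /mem_subseq3/and3P[_ /luF]; rewrite bv.
Qed.

End Disjoint.

Section TopRun.
Variables (lu lV lv : seq 'I_m) (t : 'I_m).
Hypotheses (V0 : lV != [::]) (Vt : all (pred1 t) lV).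
Hypotheses (tu : t \notin lu) (letu : all (fun b : 'I_m => b <= t)%N (lu ++ lv)).

Let tV : t \in lV.
Proof. by case: lV V0 Vt => //= a l _ /andP[/eqP<-]; rewrite inE eqxx. Qed.

(** The letter after the run [lV] has a smaller label, and lies between two
    occurrences of [t]. *)
Lemma mono_word_top_split : t \in lv -> (if lv is b :: _ then b != t else true) ->
  ~~ mono_word (lu ++ lV ++ lv).
Proof.
case: lv letu => // b l; rewrite all_cat /= => /and3P[_ lebt _] tl nbt.
apply/negP => /forallP/(_ t)/forallP/(_ b); rewrite leqNgt ltn_neqAle nbt lebt implybF.
case/negP; apply: subseq_trans (suffix_subseq _ _).
rewrite (@cat_subseq _ [:: t] [:: b; t]) ?sub1seq //= eqxx sub1seq.
by move: tl; rewrite inE eq_sym (negPf nbt).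
Qed.

Hypothesis tv : t \notin lv.

Lemma mem_top_run b : (b \in lu ++ lV ++ lv) = (b == t) || (b \in lu ++ lv).
Proof.
rewrite !mem_cat; have -> : (b \in lV) = (b == t).
  by apply/idP/eqP => [/(allP Vt)/eqP|->].
by rewrite orbCA.
Qed.

(** Deleting the letters labelled [t] affects neither side. *)
Lemma subseq_top_run a b : a != t -> b != t ->
  subseq [:: a; b; a] (lu ++ lV ++ lv) = subseq [:: a; b; a] (lu ++ lv).
Proof.
move=> at_ bt; transitivity (subseq [:: a; b; a] (filter (predC1 t) (lu ++ lV ++ lv))).
  by rewrite subseq_filter /= at_ bt.
rewrite !filter_cat; congr (subseq _ _).
have -> : filter (predC1 t) lV = [::].
  by apply/eqP; rewrite -[_ == _]negbK -has_filter -all_predC; apply: sub_all Vt => b0 /= ->.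
by rewrite !(all_filterP _) //; apply/allP => b0 h /=; apply: contraTneq h => ->.
Qed.

(** No letter lies between two occurrences of [t], as these form one run. *)
Lemma subseq_top_outer b : subseq [:: t; b; t] (lu ++ lV ++ lv) -> b = t.
Proof.
rewrite subseq3_cat (negPf tu) /= => /or3P[/mem_subseq3|/andP[/mem_subseq2]|].
- by rewrite (negPf tu).
- by rewrite (negPf tu).
rewrite subseq3_cat (negPf tv) /= andbF /=.
case/or3P=> [/mem_subseq3|/andP[_ /mem_subseq2]|/mem_subseq3].
- by case/and3P=> _ /(allP Vt)/eqP.
- by rewrite (negPf tv) andbF.
- by rewrite (negPf tv).
Qed.

Lemma mono_word_top_run : mono_word (lu ++ lV ++ lv) = mono_word (lu ++ lv).
Proof.
apply/forallP/forallP => h a; apply/forallP => b; apply/implyP => s.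
  apply: (implyP (forallP (h a) b)); apply: subseq_trans s _.
  by rewrite cat_subseq // suffix_subseq.
have [eat|at_] := eqVneq a t; first by move: s; rewrite eat => /subseq_top_outer->.
have [->|bt] := eqVneq b t; last first.
  by apply: (implyP (forallP (h a) b)); rewrite -subseq_top_run.
have /mem_subseq3/andP[+ _] := s; rewrite mem_top_run (negPf at_) /=.
exact: (allP letu).
Qed.

Lemma inner_label_top_run b : b != t ->
  inner_label (lu ++ lV ++ lv) b = inner_label (lu ++ lv) b.
Proof.
move=> bt; apply: eq_existsb => a; have [->|ab] //= := eqVneq a b.
have [eat|at_] := eqVneq a t; last by rewrite subseq_top_run.
rewrite eat; apply/idP/idP => [/subseq_top_outer ebt|/mem_subseq3].
  by rewrite ebt eqxx in bt.
by rewrite mem_cat (negPf tu) (negPf tv).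
Qed.

(** A block enclosing the run of [t] has a letter on either side of it. *)
Lemma inner_label_top :
  inner_label (lu ++ lV ++ lv) t = ~~ [disjoint [set b in lu] & [set b in lv]].
Proof.
rewrite -setI_eq0; apply/existsP/set0Pn => [[a /andP[at_]]|[a]]; last first.
  rewrite !inE => /andP[au av]; exists a; rewrite (contraNneq _ tu) => [|<- //].
  by rewrite (@cat_subseq _ [:: a] [:: t; a]) ?(@cat_subseq _ [:: t] [:: a]) ?sub1seq.
have aV : a \notin lV by apply: contra at_ => /(allP Vt).
rewrite subseq3_cat => /or4P[/mem_subseq3|/andP[/mem_subseq2]|/andP[au]|];
  rewrite ?(negPf tu) ?andbF //.
  rewrite subseq2_cat => /or3P[/mem_subseq2|/andP[_ av]|/mem_subseq2].
  - by rewrite (negPf aV) andbF.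
  - by exists a; rewrite !inE au.
  - by rewrite (negPf tv).
rewrite subseq3_cat (negPf aV) /= => /or3P[/mem_subseq3|/andP[/mem_subseq2]|/mem_subseq3].
- by rewrite (negPf aV).
- by rewrite (negPf aV).
- by rewrite (negPf tv) andbF.
Qed.

End TopRun.

Section Factor.

Variables (K : comNzRingType) (Y : Type) (KO KI : seq Y -> K).
Implicit Types (u v w V : seq ('I_m * Y)).

Definition label_factor w b :=
  (if inner_label (labels w) b then KI else KO) (subword w b).

(** The right-hand side of the theorem for a word of labelled letters, with
    [KO] and [KI] giving the factors of the outer and of the inner blocks. *)
Definition mono_product w : K :=
  if mono_word (labels w) then \prod_(b in labels w) label_factor w b else 0.

Lemma labels_cat u v : labels (u ++ v) = labels u ++ labels v.
Proof. exact: map_cat. Qed.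

Lemma subword_cat u v b : subword (u ++ v) b = subword u b ++ subword v b.
Proof. by rewrite /subword filter_cat map_cat. Qed.

Lemma subword_notin u b : b \notin labels u -> subword u b = [::].
Proof.
move=> bu; rewrite /subword; elim: u bu => //= x u IHu; rewrite inE negb_or eq_sym.
by case/andP=> /negPf-> /IHu.
Qed.

Lemma subword_all u b : all (pred1 b) (labels u) -> subword u b = [seq x.2 | x <- u].
Proof.
by move=> h; rewrite /subword; congr map; apply/all_filterP; rewrite all_map in h.
Qed.

(** The two letters labelled [a] of a pattern a, b, a lie in the same word, hence
    so does the letter between them: no pattern involves both words. *)
Lemma mono_product_cat u v : [disjoint [set b in labels u] & [set b in labels v]] ->
  mono_product (u ++ v) = mono_product u * mono_product v.
Proof.
move=> duv; rewrite /mono_product labels_cat mono_word_cat //.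
case: (mono_word _); last by rewrite mul0r.
case: (mono_word _); last by rewrite mulr0.
have vF b : b \in labels u -> b \notin labels v.
  by move=> bu; have /pred0P/(_ b) /= := duv; rewrite !inE bu => /= ->.
rewrite /= (eq_bigl [predU (mem (labels u)) & (mem (labels v))]); last first.
  by move=> b; rewrite /= mem_cat.
rewrite bigU /=; last first.
  by apply/pred0P => b /=; apply/negP => /andP[/vF/negPf->].
congr (_ * _); apply: eq_bigr => b bw; rewrite /label_factor labels_cat subword_cat.
  by rewrite inner_label_catl // (subword_notin (vF _ bw)) cats0.
by rewrite inner_label_catr // [subword u b]subword_notin //; apply: contraL bw => /vF.
Qed.

(** Removing a run of maximal label preserves monotonicity and the other inner
    blocks; the run itself is inner exactly when a label occurs on both of its
    sides. *)
Lemma mono_product_top_run u V v t : labels V != [::] -> all (pred1 t) (labels V) ->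
  t \notin labels u -> t \notin labels v -> all (fun b : 'I_m => b <= t)%N (labels (u ++ v)) ->
  mono_product (u ++ V ++ v) =
    (if [disjoint [set b in labels u] & [set b in labels v]] then KO else KI) [seq x.2 | x <- V]
    * mono_product (u ++ v).
Proof.
move=> V0 Vt tu tv let_; rewrite /mono_product !labels_cat.
rewrite labels_cat in let_.
rewrite (mono_word_top_run V0 Vt tu) //; case: (mono_word _); last by rewrite mulr0.
rewrite (bigD1 t) ?(mem_top_run _ _ V0 Vt) ?eqxx //=; congr (_ * _).
  rewrite /label_factor !labels_cat (inner_label_top V0 Vt tu tv) if_neg !subword_cat.
  by rewrite (subword_notin tu) (subword_notin tv) cats0 subword_all.
apply: eq_big => b; last first.
  case/andP=> _ bt; rewrite /label_factor !labels_cat (inner_label_top_run Vt tu tv bt).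
  rewrite !subword_cat.
  rewrite [subword V b]subword_notin //.
  by apply: contra bt => /(allP Vt).
rewrite (mem_top_run _ _ V0 Vt); have [->|] //= := eqVneq b t; last by rewrite andbT.
by rewrite mem_cat (negPf tu) (negPf tv).
Qed.

End Factor.
End LabelWords.

(** * Summing over the copies of a block *)

Section Lifts.

Variables (m : nat) (Y : eqType).
Implicit Types (w u v : seq ('I_m * Y)) (z : seq (nat * Y)) (iv : 'I_m -> seq nat).

(** The words obtained by replacing each label [b] by an index from [iv b];
    their values add up to the value of the product of the sums of copies. *)
Definition lifts iv w : seq (seq (nat * Y)) :=
  foldr (fun x zs => [seq (c, x.2) :: z | c <- iv x.1, z <- zs]) [:: [::]] w.

Lemma lifts_cat iv u v : lifts iv (u ++ v) = [seq a ++ b | a <- lifts iv u, b <- lifts iv v].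
Proof.
elim: u => [|x u IHu]; first by rewrite /= cats0 map_id.
rewrite /= IHu; elim: (iv x.1) => //= c s ->; rewrite map_cat flatten_cat; congr (_ ++ _).
by rewrite allpairs_mapl map_allpairs.
Qed.

Lemma mem_lifts iv w z : (z \in lifts iv w) =
  (map snd z == map snd w) && all2 (fun c b => c \in iv b) (map fst z) (labels w).
Proof.
elim: w z => [|x w IHw] [|[c y] z] //=.
  by apply/negP => /allpairsP[[? ?] []].
rewrite eqseq_cons; apply/allpairsP/idP => [[[c' z'] [/= hc hz [-> -> ->]]]|].
  by rewrite eqxx hc /= -IHw.
by case/andP=> /andP[/eqP -> ez] /andP[hc hz]; exists (c, z); split => //=; rewrite IHw ez.
Qed.

Lemma uniq_lifts iv w : (forall b, uniq (iv b)) -> uniq (lifts iv w).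
Proof.
move=> uiv; elim: w => //= x w IHw; apply: allpairs_uniq => //.
by move=> [c z] [c' z'] _ _ [-> ->].
Qed.

(** The left-hand side can be split along concatenations of words; the
    right-hand side is indexed like the sums defining the values at dilated
    variables. *)
Lemma big_lifts (R : nmodType) (f : seq (nat * Y) -> R) iv n (l : 'I_n -> 'I_m)
    (X : 'I_n -> Y) (M : 'I_n -> nat) :
  (forall b, uniq (iv b)) -> (forall k, M k = size (iv (l k))) ->
  \sum_(z <- lifts iv [seq (l k, X k) | k <- enum 'I_n]) f z =
  \sum_(i : {dffun forall k, 'I_(M k)}) f (word (fun k => nth 0%N (iv (l k)) (i k)) X).
Proof.
move=> uiv sM.
pose g (i : {dffun forall k, 'I_(M k)}) := word (fun k => nth 0%N (iv (l k)) (i k)) X.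
transitivity (\sum_(z <- [seq g i | i <- enum {: {dffun forall k, 'I_(M k)}}]) f z).
  apply: perm_big; apply: uniq_perm; first exact: uniq_lifts.
    rewrite map_inj_uniq ?enum_uniq // => i j ij; apply/ffunP => k; apply: val_inj.
    have /(congr1 fst) /= : (nth 0%N (iv (l k)) (i k), X k) = (nth 0%N (iv (l k)) (j k), X k).
      by move/eq_in_map: ij => /(_ k); apply; rewrite mem_enum.
    by move/eqP; rewrite nth_uniq -?sM //; move/eqP.
  move=> z; rewrite mem_lifts; apply/idP/mapP => [|[i _ ->]]; last first.
    rewrite /labels -!map_comp eqxx /= all2E !size_map eqxx /= zip_map all_map.
    by apply/allP => k _ /=; rewrite mem_nth // -sM.
  case/andP=> /eqP ez; rewrite /labels -map_comp all2E => /andP[_ /all_nthP hz].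
  have sz : size z = n by rewrite -(size_map snd) ez 2!size_map size_enum_ord.
  have hi (k : 'I_n) : (index (nth 0%N (map fst z) k) (iv (l k)) < M k)%N.
    rewrite sM index_mem; move: (hz (0%N, l k) k).
    rewrite size_zip 2!size_map size_enum_ord sz minnn ltn_ord => /(_ isT).
    rewrite nth_zip /=; last by rewrite 2!size_map sz size_enum_ord.
    by rewrite (nth_map k) ?size_enum_ord // nth_ord_enum.
  pose i : {dffun forall k, 'I_(M k)} := [ffun k => Ordinal (hi k)].
  have iE k : i k = index (nth 0%N (map fst z) k) (iv (l k)) :> nat by rewrite /i ffunE.
  exists i; first by rewrite mem_enum.
  clearbody i; rewrite -[z]zip_unzip /g /word -[RHS]zip_unzip; congr zip; last first.
    by rewrite [LHS]ez /unzip2 -[LHS]map_comp -[RHS]map_comp.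
  rewrite /unzip1 -[RHS]map_comp.
  have sz1 : size (map fst z) = n by rewrite size_map.
  apply: (@eq_from_nth _ 0%N); rewrite ?sz1 ?(size_map _ (enum _)) ?size_enum_ord // => k kn.
  rewrite (nth_map (Ordinal kn)) ?size_enum_ord //= (nth_ord_enum _ (Ordinal kn)) iE /=.
  by rewrite nth_index // -index_mem -sM; apply: (hi (Ordinal kn)).
by rewrite big_map big_enum.
Qed.

End Lifts.

Section LabelSums.

Variables (K : fieldType) (A : nuAlgType K) (m : nat).
Implicit Types (w u v : seq ('I_m * A)) (iv : 'I_m -> seq nat) (t : 'I_m).

Definition lift_sum (phi : {scalar A}) (S : spread_system phi) iv w : K :=
  \sum_(z <- lifts iv w) word_val S z.

Lemma lift_sum_nil (phi : {scalar A}) (S : spread_system phi) iv : lift_sum S iv [::] = 1.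
Proof. by rewrite /lift_sum big_seq1. Qed.

Definition separated iv := forall (a b : 'I_m) c d, (a < b)%N -> c \in iv a -> d \in iv b ->
  (c < d)%N.

Definition below_label t w := if w is x :: _ then (x.1 < t)%N else true.

Lemma below_lift iv t c v z : separated iv -> c \in iv t -> below_label t v ->
  z \in lifts iv v -> below c z.
Proof.
move=> siv ct; rewrite mem_lifts; case: v z => [|x v] [|[d y] z] //= xt.
by case/andP=> _ /andP[hd _]; apply: siv xt hd ct.
Qed.

Lemma lifts_rev iv u z : (rev z \in lifts iv (rev u)) = (z \in lifts iv u).
Proof.
rewrite !mem_lifts /labels !map_rev (can_eq revK).
have [e|] //= := eqVneq (map snd z) (map snd u).
have sz : size (map fst z) = size (map fst u).
  by rewrite size_map -(size_map snd) e !size_map.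
by rewrite !all2E !size_rev -rev_zip // all_rev.
Qed.

Lemma below_rev_lift iv t c u z : separated iv -> c \in iv t -> below_label t (rev u) ->
  z \in lifts iv u -> below c (rev z).
Proof. by move=> siv ct hu hz; apply: (below_lift siv ct hu); rewrite lifts_rev. Qed.

Variables (phi psi : {scalar A}) (S : spread_system phi) (S' : spread_system psi).
Hypothesis rS : cmonotone_rules psi S.
Hypothesis rS' : monotone_rules S'.

(** Every lift of the run of [t] satisfies the hypothesis of [block_peak], as the
    intervals of indices are separated in the order of the labels. *)
Lemma lift_sum_block iv u V v t : separated iv -> all (pred1 t) (labels V) ->
  below_label t (rev u) -> below_label t v ->
  lift_sum S iv (u ++ V ++ v) =
    lift_sum S iv u * (lift_sum S iv V - lift_sum S' iv V) * lift_sum S iv v +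
    lift_sum S' iv V * lift_sum S iv (u ++ v).
Proof.
move=> siv Vt hu hv; rewrite /lift_sum !lifts_cat.
have -> : \sum_(z <- [seq a ++ b | a <- lifts iv u,
      b <- [seq a ++ b | a <- lifts iv V, b <- lifts iv v]]) word_val S z =
    \sum_(a <- lifts iv u) \sum_(b <- lifts iv V) \sum_(c <- lifts iv v)
      word_val S (a ++ b ++ c).
  rewrite big_allpairs_dep; apply: eq_bigr => a _; rewrite big_allpairs_dep.
  by [].
rewrite [in RHS]big_allpairs_dep /=.
set D := (\sum_(z <- lifts iv V) word_val S z - _); set Fv := \sum_(z <- lifts iv v) _.
set G := \sum_(z <- lifts iv V) word_val S' z.
transitivity (\sum_(a <- lifts iv u) (word_val S a * D * Fv +
    G * \sum_(c <- lifts iv v) word_val S (a ++ c))); last first.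
  by rewrite big_split /= -!mulr_suml -mulr_sumr.
apply: eq_big_seq => a ha.
transitivity (\sum_(b <- lifts iv V) (word_val S a * (word_val S b - word_val S' b) * Fv +
    word_val S' b * \sum_(c <- lifts iv v) word_val S (a ++ c))); last first.
  by rewrite big_split /= -!mulr_suml -mulr_sumr sumrB.
apply: eq_big_seq => b hb; rewrite !mulr_sumr -big_split /=.
apply: eq_big_seq => c hc; apply: (block_peak rS rS').
apply/allP => y yb; have yt : y.1 \in iv t.
  move: hb; rewrite mem_lifts => /andP[_]; elim: b {hc} (labels V) Vt yb => [|x b IHb] [|d l] //=.
  case/andP=> /eqP-> hl; rewrite inE => /orP[/eqP->|yb] /andP[] //.
  by move=> _; apply: IHb.
by rewrite (below_rev_lift siv yt hu ha) (below_lift siv yt hv hc).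
Qed.

End LabelSums.

(** * Kernels and quasi-meets *)

Section Kernels.

Variable n : nat.
Implicit Types (i j : 'I_n -> nat) (p : osp n).

(** The ordered kernel depends only on the order relations between the indices.
    The increasing map [g] carrying the values of [i] to those of [j] carries one
    sorted list of values to the other. *)
Lemma eq_kernel i j : (forall k l, (i k <= i l)%N = (j k <= j l)%N) -> kernel i = kernel j.
Proof.
move=> ij; apply: val_inj => /=; rewrite /level_sets.
have eij k l : (i k == i l) = (j k == j l) by rewrite !eqn_leq !ij.
(* On the values of i this is the map i k |-> j k; the maximum makes it monotone. *)
pose g v := (\max_(k | i k <= v) j k)%N.
have gi k : g (i k) = j k.
  apply/eqP; rewrite eqn_leq; apply/andP; split; last exact: leq_bigmax_cond.
  by apply/bigmax_leqP => l; rewrite ij.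
have -> : sort leq (undup (codom j)) = map g (sort leq (undup (codom i))).
  apply: (sorted_eq leq_trans anti_leq); first exact: (sort_sorted leq_total).
    apply: (homo_sorted _ _ (sort_sorted leq_total _)) => v w vw.
    apply/bigmax_leqP => k kv; apply: leq_bigmax_cond; exact: leq_trans kv vw.
  apply: uniq_perm; rewrite ?sort_uniq ?undup_uniq //.
    rewrite map_inj_in_uniq ?sort_uniq ?undup_uniq // => v w.
    rewrite !mem_sort !mem_undup => /codomP[k ->] /codomP[l ->].
    by rewrite !gi => /eqP; rewrite -eij => /eqP.
  move=> v; rewrite mem_sort mem_undup; apply/codomP/mapP => [[k ->]|[w]].
    by exists (i k); rewrite ?gi // mem_sort mem_undup codom_f.
  by rewrite mem_sort mem_undup => /codomP[k ->] ->; exists k; rewrite gi.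
rewrite -map_comp; apply/eq_in_map => v; rewrite mem_sort mem_undup => /codomP[k ->].
by apply/setP => l; rewrite !inE /= gi eij.
Qed.

(** Listing the level sets of all values below a bound, and then removing the
    empty ones, avoids sorting. *)
Lemma level_sets_iota j M : (forall k, j k < M)%N ->
  level_sets j = rm_empty [seq [set k | j k == v] | v <- iota 0 M].
Proof.
move=> jM; rewrite /level_sets /rm_empty filter_map; congr map.
apply: (sorted_eq leq_trans anti_leq); first exact: (sort_sorted leq_total).
  by apply: sorted_filter; [exact: leq_trans|exact: iota_sorted].
apply: uniq_perm; rewrite ?sort_uniq ?undup_uniq ?filter_uniq ?iota_uniq // => v.
rewrite mem_sort mem_undup mem_filter mem_iota add0n /=; apply/codomP/andP.
  by case=> k ->; split=> //; apply/set0Pn; exists k; rewrite inE.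
by case=> /set0Pn[k]; rewrite inE => /eqP<- _; exists k.
Qed.

Lemma iotaM a c : iota 0 (a * c) = [seq (x * c + y)%N | x <- iota 0 a, y <- iota 0 c].
Proof.
elim: a => // a IHa; rewrite -[a.+1]addn1 iotaD map_cat flatten_cat -IHa mulnDl mul1n.
rewrite iotaD; congr (_ ++ _); rewrite /= cats0 add0n.
by rewrite -[in LHS](addn0 (a * c)%N) iotaDl.
Qed.

Lemma rm_empty_allpairs (s t : seq {set 'I_n}) :
  rm_empty [seq B :&: C | B <- s, C <- rm_empty t] = rm_empty [seq B :&: C | B <- s, C <- t].
Proof.
elim: s => //= B s IHs; rewrite /rm_empty !filter_cat; congr (_ ++ _); last exact: IHs.
clear IHs.
elim: t => //= C t IHt; have [->|_] := eqVneq C set0; last by rewrite /= IHt.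
by rewrite setI0 eqxx.
Qed.

(** The blocks of the quasi-meet are the level sets of the pairs
    (pi(k), i(k)) in lexicographic order, and c * M + d encodes the pair (c, d)
    for d < M. *)
Lemma quasi_meet_kernel p i M : (forall k, i k < M)%N ->
  quasi_meet p (kernel i) = kernel (fun k => osp_pos p k * M + i k)%N.
Proof.
move=> iM; have pM k : (osp_pos p k * M + i k < size p * M)%N.
  have := ltn_ord (osp_pos p k); have := iM k; nia.
apply: val_inj => /=; rewrite (level_sets_iota pM) (level_sets_iota iM) rm_empty_allpairs.
have {1}-> : (p : seq _) = [seq [set k | osp_pos p k == v :> nat] | v <- iota 0 (size p)].
  apply: (@eq_from_nth _ set0); rewrite ?size_map ?size_iota // => v vp.
  rewrite (nth_map 0%N) ?size_iota // nth_iota // add0n; apply/setP => k.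
  by rewrite inE (mem_nth_osp (Ordinal vp)).
congr rm_empty; rewrite iotaM map_allpairs allpairs_mapl allpairs_mapr.
congr flatten; apply: eq_map => x; apply/eq_in_map => y.
rewrite mem_iota => /andP[_ yM]; apply/setP => k.
rewrite !inE; have ik := iM k; apply/andP/eqP => [[/eqP-> /eqP->] //|e].
have : ((osp_pos p k * M + i k) %% M = (x * M + y) %% M)%N by rewrite e.
rewrite !modnMDl !modn_small // => eiy; split; last exact/eqP.
by apply/eqP; move: e; rewrite eiy => /addIn/eqP; rewrite eqn_pmul2r ?(leq_trans _ ik) // => /eqP.
Qed.

End Kernels.

Section PhiDot.

Variables (K : fieldType) (A : nuAlgType K) (phi : {scalar A}) (S : spread_system phi).

Lemma eq_word_val n (i j : 'I_n -> nat) (X : 'I_n -> A) :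
  (forall k l, (i k <= i l)%N = (j k <= j l)%N) ->
  word_val S (word i X) = word_val S (word j X).
Proof.
move=> /eq_kernel/(@sp_spread _ _ _ S _ _ _ X); rewrite /word_val /word.
by case: (enum 'I_n).
Qed.

(** The total of the sizes serves as a common period, so that the index
    intervals of the blocks are disjoint and follow the order of the blocks. *)
Definition stacked m (N : 'I_m -> nat) (b : 'I_m) := iota (b * \sum_c N c) (N b).

Lemma leq_stack m (N : 'I_m -> nat) b : (N b <= \sum_c N c)%N.
Proof. by rewrite (bigD1 b) //= leq_addr. Qed.

Lemma stacked_separated m (N : 'I_m -> nat) : separated (stacked N).
Proof.
move=> a b c d ab; rewrite !mem_iota => /andP[_ ca] /andP[bd _].
apply: leq_trans bd; apply: leq_trans ca _.
have := leq_stack N a; set s := \sum_c N c => Ns.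
apply: (@leq_trans (a.+1 * s)); first by rewrite mulSn addnC leq_add2r.
by rewrite leq_mul2r ab orbT.
Qed.

Definition osp_word n (p : osp n) (X : 'I_n -> A) : seq ('I_(size p) * A) :=
  [seq (osp_pos p k, X k) | k <- enum 'I_n].

(** By spreadability, the partition refined by the kernel of the indices may be
    replaced by the stacked indices, whose kernel it is. *)
Lemma phi_dotE n (p : osp n) (N : 'I_(size p) -> nat) (X : 'I_n -> A) : (0 < n)%N ->
  phi_dot S p (fun k => N (osp_pos p k)) X = lift_sum S (stacked N) (osp_word p X).
Proof.
move=> n0; rewrite /lift_sum /osp_word (@big_lifts _ _ _ _ _ _ _ _ (fun k => N (osp_pos p k))).
- apply: eq_bigr => i _; rewrite (@quasi_meet_kernel _ _ _ (\sum_c N c)).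
    rewrite phi_part_kernel.
    have -> z : word_val S (word z X) = sp_eval S (word z X).
      by rewrite /word; have := size_enum_ord n; case: (enum _) => [n1|//]; rewrite -n1 in n0.
    congr (sp_eval S _); apply: eq_map => k; rewrite nth_iota //.
  by move=> k; apply: leq_trans (ltn_ord _) (leq_stack _ _).
- by move=> b; apply: iota_uniq.
- by move=> k; rewrite size_iota.
Qed.

End PhiDot.

(** * Words with one label *)

Section Binomials.
Variable K : numFieldType.

(** The polynomial C(x, j + 1) / x. *)
Definition bin_quot j (x : K) : K := (\prod_(i < j) (x - i.+1%:R)) / j.+1`!%:R.

Lemma bin_quotE N j : 'C(N, j.+1)%:R = N%:R * bin_quot j N%:R.
Proof.
have f0 : (j.+1`!)%:R != 0 :> K by rewrite pnatr_eq0 -lt0n fact_gt0.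
rewrite /bin_quot mulrA; apply: (canRL (mulfK f0)); rewrite -natrM bin_ffact {f0}.
elim: j => [|j IHj]; first by rewrite ffactn1 big_ord0 mulr1.
rewrite ffactnSr natrM IHj big_ord_recr /= mulrA.
have [ltjN|leNj] := ltnP j N; first by rewrite natrB.
(* For 0 < N <= j both sides vanish: the factor N - (i + 1) is 0 for i + 1 = N. *)
case: N leNj {IHj} => [|N] leNj; first by rewrite !mul0r.
suff -> : \prod_(i < j) (N.+1%:R - i.+1%:R) = 0 :> K by rewrite mulr0 !mul0r.
by rewrite (bigD1 (Ordinal leNj)) //= subrr mul0r.
Qed.

End Binomials.

Lemma leq_enum_val N (T : {set 'I_N}) (a b : 'I_#|T|) :
  (enum_val a <= enum_val b)%N = (a <= b)%N.
Proof.
have lt_val (c d : 'I_#|T|) : (c < d)%N -> (enum_val c < enum_val d)%N.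
  move=> cd; have x0 := enum_val c; rewrite !(enum_val_nth x0).
  have : sorted (relpre val ltn) (enum T).
    rewrite {1}/enum_mem -enumT; apply: sorted_filter => [x y z|]; first exact: ltn_trans.
    by rewrite -sorted_map val_enum_ord iota_ltn_sorted.
  move/(sorted_ltn_nth _ x0); apply; rewrite ?inE -?cardE //.
  by move=> x y z; apply: ltn_trans.
have [/lt_val/ltnW//|/lt_val ba|/val_inj->] := ltngtP a b; last by rewrite leqnn.
by rewrite leqNgt ba.
Qed.

Section OneBlock.

Variables (K : numFieldType) (A : nuAlgType K) (phi : {scalar A}) (S : spread_system phi).

(** The contribution of the index families using all of [j] copies. *)
Definition packed_sum n (X : 'I_n -> A) j : K :=
  \sum_(i : {ffun 'I_n -> 'I_j} | [set i k | k : 'I_n] == setT) word_val S (word (fun k => i k) X).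

(** The increasing enumeration of [T] identifies the families with image [T] with
    those onto #|T| copies, and preserves kernels. *)
Lemma packed_sum_image n (X : 'I_n -> A) N (T : {set 'I_N}) : (0 < n)%N ->
  \sum_(i : {ffun 'I_n -> 'I_N} | [set i k | k : 'I_n] == T) word_val S (word (fun k => i k) X) =
  packed_sum X #|T|.
Proof.
move=> n0; have [->|/set0Pn[x0 Tx0]] := eqVneq T set0.
  rewrite cards0 /packed_sum [RHS]big_pred0 => [|i]; last by case: (i (Ordinal n0)).
  rewrite big_pred0 // => i.
  by apply/negP => /eqP/setP/(_ (i (Ordinal n0))); rewrite inE imset_f.
pose h (i : {ffun 'I_n -> 'I_#|T|}) := [ffun k => enum_val (i k)].
pose h' (i : {ffun 'I_n -> 'I_N}) := [ffun k => enum_rank_in Tx0 (i k)].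
rewrite /packed_sum (reindex_onto h h'); last first.
  move=> i /eqP iT; apply/ffunP => k; rewrite !ffunE enum_rankK_in // -iT.
  exact: imset_f.
have hK i : h' (h i) = i by apply/ffunP => k; rewrite !ffunE enum_valK_in.
apply: eq_big => [i|i _]; last first.
  apply: eq_word_val => k l; by rewrite /h !ffunE leq_enum_val.
rewrite hK eqxx andbT; apply/eqP/eqP => [hT|iT].
  apply/setP => y; rewrite inE.
  have : enum_val y \in [set h i k | k : 'I_n] by rewrite hT enum_valP.
  case/imsetP => k _; rewrite ffunE => /enum_val_inj->.
  exact: imset_f.
apply/setP => x; apply/imsetP/idP => [[k _ ->]|Tx]; first by rewrite ffunE enum_valP.
have : enum_rank_in Tx0 x \in [set i k | k : 'I_n] by rewrite iT inE.
by case/imsetP => k _ e; exists k; rewrite // ffunE -e enum_rankK_in.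
Qed.

Lemma packed_sum_gt n (X : 'I_n -> A) j : (n < j)%N -> packed_sum X j = 0.
Proof.
move=> nj; rewrite /packed_sum big_pred0 // => i; apply/negP => /eqP iT.
by have := leq_imset_card i 'I_n; rewrite iT cardsT !card_ord leqNgt nj.
Qed.

(** Families are grouped by their image; there are C(N, j) images of size j, and
    they contribute equally. *)
Lemma sum_word_val n (X : 'I_n -> A) N : (0 < n)%N ->
  \sum_(i : {ffun 'I_n -> 'I_N}) word_val S (word (fun k => i k) X) =
  \sum_(j < n) 'C(N, j.+1)%:R * packed_sum X j.+1.
Proof.
move=> n0; rewrite (partition_big (fun i : {ffun 'I_n -> 'I_N} => [set i k | k : 'I_n]) xpredT) //=.
under eq_bigr do rewrite packed_sum_image //.
rewrite (partition_big (fun T : {set 'I_N} => inord #|T| : 'I_N.+1) xpredT) //=.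
have cardT (T : {set 'I_N}) : (inord #|T| : 'I_N.+1) = #|T| :> nat.
  by rewrite inordK // ltnS; have := max_card T; rewrite card_ord.
transitivity (\sum_(j < N.+1) 'C(N, j)%:R * packed_sum X j).
  apply: eq_bigr => j _; rewrite (eq_bigl (fun T : {set 'I_N} => #|T| == j)); last first.
    by move=> T; rewrite -val_eqE /= cardT.
  rewrite (eq_bigr (fun=> packed_sum X j)) => [|T /eqP-> //].
  rewrite sumr_const mulr_natl; congr (_ *+ _).
  by have := card_draws 'I_N j; rewrite card_ord cardsE => <-.
have p0 : packed_sum X 0 = 0.
  by rewrite /packed_sum big_pred0 // => i; case: (i (Ordinal n0)).
have widen a b : (a <= b)%N -> (forall j, (a <= j)%N -> 'C(N, j)%:R * packed_sum X j = 0) ->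
    \sum_(j < a) 'C(N, j)%:R * packed_sum X j = \sum_(j < b) 'C(N, j)%:R * packed_sum X j.
  move=> ab a0; rewrite (big_ord_widen _ (fun j => 'C(N, j)%:R * packed_sum X j) ab) big_mkcond.
  by apply: eq_bigr => j _; case: ltnP => // /a0.
(* C(N, j) vanishes for j > N and the packed sum for j > n, so either bound will do. *)
rewrite (widen _ (N.+1 + n.+1)%N) ?leq_addr // => [|j Nj]; last by rewrite bin_small // mul0r.
rewrite -(widen n.+1) ?leq_addl // => [|j nj]; last by rewrite packed_sum_gt // mulr0.
by rewrite big_ord_recl p0 mulr0 add0r.
Qed.

Lemma meval_prodXB m (t : 'I_m) j (v : 'I_m -> K) :
  (\prod_(i < j) ('X_t - (i.+1%:R)%:MP) : {mpoly K[m]}).@[v] = \prod_(i < j) (v t - i.+1%:R).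
Proof.
rewrite (big_morph _ (mevalM v) (meval1 v)).
by apply: eq_bigr => i _; rewrite mevalB mevalXU mevalC.
Qed.

(** The linear coefficient in N of the sum over all families of N copies, which
    is a combination of the binomial coefficients C(N, j + 1). *)
Definition seq_cumulant (V : seq A) : K :=
  \sum_(j < size V) packed_sum (fun k : 'I_(size V) => nth 0 V k) j.+1 * bin_quot j 0.

(** By spreadability the indices of the block [t] may be taken to be the first N_t
    ones; the sum is then a combination of the C(N_t, j + 1), all divisible by
    N_t. *)
Lemma lift_sum_one_block m (t : 'I_m) (w : seq ('I_m * A)) :
  labels w != [::] -> all (pred1 t) (labels w) ->
  multilinear_term [set t] (fun N => lift_sum S (stacked N) w)
    (seq_cumulant [seq x.2 | x <- w]).
Proof.
move=> w0 wt; set V := [seq x.2 | x <- w]; pose X (k : 'I_(size V)) := nth 0 V k.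
have V0 : (0 < size V)%N by rewrite size_map -(size_map fst) lt0n size_eq0.
have wE : w = [seq (t, X k) | k <- enum 'I_(size V)].
  have VE : [seq X k | k <- enum 'I_(size V)] = V.
    by rewrite (map_comp (nth 0 V) (@nat_of_ord _)) val_enum_ord map_nth_iota0 // take_size.
  rewrite (map_comp (pair t) X) VE /V; elim: (w) wt => //= -[b x] u IHu /andP[/eqP /= -> /IHu <-].
  by [].
exists (\sum_(j < size V) (packed_sum X j.+1 / j.+1`!%:R) *:
  \prod_(i < j) ('X_t - (i.+1%:R)%:MP)) => [N|].
  rewrite big_set1 wE /lift_sum (@big_lifts _ _ _ _ _ _ _ _ (fun=> N t)) => [|b|k]; last 2 first.
  - exact: iota_uniq.
  - by rewrite size_iota.
  transitivity (\sum_(i : {ffun 'I_(size V) -> 'I_(N t)}) word_val S (word (fun k => i k) X)).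
    apply: eq_bigr => i _; apply: eq_word_val => k l.
    by rewrite !nth_iota // leq_add2l.
  rewrite sum_word_val // (big_morph _ (mevalD _) (meval0 _)) mulr_sumr.
  apply: eq_bigr => j _; rewrite bin_quotE mevalZ meval_prodXB /bin_quot.
  by ring.
rewrite (big_morph _ (mevalD _) (meval0 _)) /seq_cumulant; apply: eq_bigr => j _.
by rewrite mevalZ meval_prodXB /bin_quot; ring.
Qed.

End OneBlock.

(** * Removing the last block *)

Section LastBlock.

Variables (K : numFieldType) (A : nuAlgType K) (phi psi : {scalar A}).
Variables (S : spread_system phi) (S' : spread_system psi).
Hypothesis rS : cmonotone_rules psi S.
Hypothesis rS' : monotone_rules S'.
Variable m : nat.
Implicit Types w u v V : seq ('I_m * A).

(** The last condition says that the run [V] is maximal to the right: the next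
    letter, if any, has a label other than [t]. *)
Lemma first_top_run w : w != [::] -> exists u V v t,
  [/\ w = u ++ V ++ v, labels V != [::], all (pred1 t) (labels V)
    & [/\ all (fun b : 'I_m => b < t)%N (labels u),
          all (fun b : 'I_m => b <= t)%N (labels v) & below_label t v]].
Proof.
elim: w => [//|[b x] w IHw] _; have [->|/IHw] := eqVneq w [::].
  by exists [::], [:: (b, x)], [::], b; split; rewrite //= eqxx.
move=> [u [V [v [t [-> V0 Vt [ut vt hv]]]]]].
have [bt|tb] := ltnP b t.
  by exists ((b, x) :: u), V, v, t; split => //; split => //=; rewrite bt.
have [/andP[/eqP ebt /eqP u0]|neq] := boolP ((b == t) && (u == [::])).
  by exists [::], ((b, x) :: V), v, t; split; rewrite ?u0 //= ebt eqxx.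
exists [::], [:: (b, x)], (u ++ V ++ v), b; split; rewrite //= ?eqxx //; split => //.
  rewrite !labels_cat !all_cat; apply/and3P; split; apply/allP => c cw.
  - by apply: leq_trans (ltnW (allP ut c cw)) tb.
  - by rewrite (eqP (allP Vt c cw)).
  - by apply: leq_trans (allP vt c cw) tb.
case: u ut neq => [_|[c y] u /= /andP[ct _] _]; last exact: leq_trans ct tb.
rewrite eqxx andbT; case: V V0 Vt => // -[c y] V _ /= /andP[/eqP-> _] neq.
by rewrite ltn_neqAle tb andbT eq_sym.
Qed.

(** Induction on the length of the word, removing the first run [V] of the
    largest label [t].  If [t] occurs again in v, both summands of
    [lift_sum_block] are products of words sharing [t], and the word is not
    monotone.  Otherwise the second summand contributes K'(V) c(u v), and the
    first one (K(V) - K'(V)) c(u) c(v) if u and v have no common label and 0 if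
    they have one, where K and K' are the linear coefficients for the two systems
    and c is the coefficient of a word. *)
Lemma lift_sum_term w :
  multilinear_term [set b in labels w] (fun N => lift_sum S (stacked N) w)
    (mono_product (seq_cumulant S) (seq_cumulant S') w).
Proof.
have [n] := ubnP (size w); elim: n w => // n IHn w; have [->|w0] := eqVneq w [::].
  move=> _; exists 1 => [N|]; last first.
    rewrite meval1 /mono_product /= ifT ?big_pred0 //.
    by apply/forallP => a; apply/forallP => b.
  by rewrite meval1 mulr1 lift_sum_nil big_pred0 // => b; rewrite !inE.
have [u [V [v [t [-> V0 Vt [ut vt hv]]]]]] := first_top_run w0; rewrite !size_cat ltnS => szw.
have V1 : (0 < size V)%N by case: (V) V0.
have tu : t \notin labels u by apply/negP => /(allP ut); rewrite ltnn.
have hu : below_label t (rev u).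
  case/lastP: (u) ut => // u' x; rewrite rev_rcons /labels map_rcons all_rcons /=.
  by case/andP.
have uvt : all (fun b : 'I_m => b <= t)%N (labels u ++ labels v).
  by rewrite all_cat vt andbT; apply: sub_all ut => b /ltnW.
have tm1 := IHn u ltac:(lia); have tm2 := IHn v ltac:(lia).
have tm3 := IHn (u ++ v) ltac:(rewrite size_cat; lia).
have tV := lift_sum_one_block S V0 Vt; have tV' := lift_sum_one_block S' V0 Vt.
set KV := seq_cumulant S _ in tV; set KV' := seq_cumulant S' _ in tV'.
pose t1 := multilinear_termM (multilinear_termM tm1
  (multilinear_termD tV (multilinear_termZ (-1) tV'))) tm2.
pose t2 := multilinear_termM tV' tm3.
have e1 : ([set b in labels u] :|: [set t]) :|: [set b in labels v] =
    [set b in labels (u ++ V ++ v)].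
  apply/setP => b; rewrite !inE !labels_cat (mem_top_run _ _ V0 Vt) mem_cat.
  by rewrite -orbA orbCA.
have e2 : [set t] :|: [set b in labels (u ++ v)] = [set b in labels (u ++ V ++ v)].
  by apply/setP => b; rewrite !inE !labels_cat (mem_top_run _ _ V0 Vt).
have := t1; have := t2; rewrite {}e1 {}e2 => {t1 t2} t2 t1.
have t3 := multilinear_termD t1 t2.
move: t3; set c := (X in multilinear_term _ _ X) => t3.
suff <- : c = mono_product (seq_cumulant S) (seq_cumulant S') (u ++ V ++ v).
  apply: eq_multilinear_term t3 => N.
  by rewrite (lift_sum_block rS rS' (@stacked_separated _ N) Vt hu hv) mulN1r.
rewrite /c.
have dt (B : {set 'I_m}) : [disjoint [set t] & B] = (t \notin B) by rewrite disjoints1.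
have dut : [disjoint [set b in labels u] & [set t]] by rewrite disjoint_sym dt inE.
have -> : [disjoint [set b in labels u] :|: [set t] & [set b in labels v]] =
    [disjoint [set b in labels u] & [set b in labels v]] && (t \notin labels v).
  by rewrite -!setI_eq0 setIUl setU_eq0 !setI_eq0 dt inE.
rewrite dut dt inE labels_cat mem_cat (negPf tu) /=.
have [tv|tv] := boolP (t \in labels v).
  rewrite andbF addr0 /mono_product !labels_cat (negPf (mono_word_top_split V0 Vt uvt tv _)) //.
  by case: (v) hv => [|x v'] //= xt; apply: contraTneq xt => ->; rewrite ltnn.
rewrite (mono_product_top_run _ _ V0 Vt tu tv) ?labels_cat // andbT.
have [duv|_] := boolP [disjoint _ & _]; last by rewrite /= add0r.
by rewrite mono_product_cat // -/KV /=; ring.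
Qed.

End LastBlock.

(** * Ordered set partitions as words of labels *)

Section OspWords.

Variables (n : nat) (p : osp n).
Implicit Types (a b : 'I_(size p)) (i j k l : 'I_n).

Definition osp_labels := [seq osp_pos p k | k <- enum 'I_n].
Definition block b := nth set0 p b.

Lemma mem_block k b : (k \in block b) = (osp_pos p k == b).
Proof. exact: mem_nth_osp. Qed.

Lemma block_witness b : exists k, osp_pos p k = b.
Proof.
have /and3P[_ p0 _] := ospP p.
have /set0Pn[k] : block b != set0 by apply: contraNneq p0 => <-; apply: mem_nth.
by rewrite mem_block => /eqP; exists k.
Qed.

Lemma block_inj : injective block.
Proof.
move=> a b ab; have [k ka] := block_witness a.
by apply/eqP; rewrite -ka -mem_block -ab mem_block ka.
Qed.

Lemma index_block b : index (block b) p = b.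
Proof.
have hb : (index (block b) p < size p)%N by rewrite index_mem mem_nth.
rewrite -[LHS]/(nat_of_ord (Ordinal hb)); congr nat_of_ord; apply: block_inj.
by rewrite /block /= nth_index // mem_nth.
Qed.

Lemma all_blocks (P : pred {set 'I_n}) : all P p = [forall b, P (block b)].
Proof.
apply/(all_nthP set0)/forallP => [h b|h i ip]; first exact: h.
exact: (h (Ordinal ip)).
Qed.

Lemma has_blocks (P : pred {set 'I_n}) : has P p = [exists b, P (block b)].
Proof.
apply/(has_nthP set0)/existsP => [[i ip h]|[b h]]; last by exists b.
by exists (Ordinal ip).
Qed.

Lemma sorted_enum_ord : sorted (relpre val ltn) (enum 'I_n).
Proof. by rewrite -sorted_map val_enum_ord iota_ltn_sorted. Qed.

(** A subsequence of the increasing list of all positions is an increasing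
    sequence of positions. *)
Lemma subseq_osp_labelsP a b :
  reflect (exists i j k, [/\ i < j < k, osp_pos p i = a, osp_pos p j = b & osp_pos p k = a]%N)
    (subseq [:: a; b; a] osp_labels).
Proof.
have ltnT : transitive (relpre (val : 'I_n -> nat) ltn).
  by move=> i j k; apply: ltn_trans.
apply: (iffP idP) => [/subseqP[s _]|[i [j [k [/andP[ij jk] <- <- e]]]]].
  rewrite -map_mask; have := mask_subseq s (enum 'I_n).
  case: (mask _ _) => [|i [|j [|k [|? ?]]]] // ijk [ea eb ea'].
  have /= := subseq_sorted ltnT ijk sorted_enum_ord.
  by rewrite andbT => ijk'; exists i, j, k; split.
rewrite -{2}e; apply: (map_subseq _ (_ : subseq [:: i; j; k] _)).
have -> : [:: i; j; k] = filter (mem [:: i; j; k]) (enum 'I_n); last exact: filter_subseq.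
apply: (irr_sorted_eq ltnT) => /=.
- by move=> x /=; rewrite ltnn.
- by rewrite ij jk.
- by apply: sorted_filter => //; apply: sorted_enum_ord.
- by move=> x; rewrite mem_filter mem_enum andbT.
Qed.

Lemma nesting_subseq a b : nesting (block a) (block b) ->
  (a != b) && subseq [:: a; b; a] osp_labels.
Proof.
case/exists_inP => i; rewrite mem_block => /eqP ia /exists_inP[j].
rewrite mem_block => /eqP ja /forall_inP h; apply/andP; split.
  apply/eqP => ab; have := h i; rewrite mem_block ia ab eqxx => /(_ isT).
  by rewrite ltnn.
have [k kb] := block_witness b; have := h k; rewrite mem_block kb eqxx => /(_ isT) /andP[ik kj].
by apply/subseq_osp_labelsP; exists i, k, j; rewrite ik kj.
Qed.

Lemma noncrossingP : noncrossing p ->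
  forall i j k l, (i < j < k)%N -> (k < l)%N -> osp_pos p i = osp_pos p k ->
    osp_pos p j = osp_pos p l -> osp_pos p i = osp_pos p j.
Proof.
rewrite /noncrossing all_blocks => /forallP nc i j k l /andP[ij jk] kl eik ejl.
apply/eqP/contraT => nij; have := nc (osp_pos p i).
rewrite all_blocks => /forallP/(_ (osp_pos p j)).
rewrite (inj_eq block_inj) nij /= => /negP[]; apply/exists_inP; exists i; rewrite ?mem_block //.
apply/exists_inP; exists j; rewrite ?mem_block //.
apply/exists_inP; exists k; rewrite ?mem_block ?eik //.
by apply/exists_inP; exists l; rewrite ?mem_block ?ejl // ij jk.
Qed.

(** For i < k < j with i, j in [a] and k in [b], any element of [b] outside the
    interval from i to j would complete a crossing. *)
Lemma nesting_noncrossing a b : noncrossing p ->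
  nesting (block a) (block b) = (a != b) && subseq [:: a; b; a] osp_labels.
Proof.
move=> nc; apply/idP/idP; first exact: nesting_subseq.
case/andP=> nab /subseq_osp_labelsP[i [k [j [/andP[ik kj] ia kb ja]]]].
apply/exists_inP; exists i; first by rewrite mem_block ia.
apply/exists_inP; exists j; first by rewrite mem_block ja.
apply/forall_inP => q; rewrite mem_block => /eqP qb; apply/andP; split.
  rewrite ltnNge leq_eqVlt; apply/negP => /orP[/eqP/val_inj eqi|qi].
    by move: nab; rewrite -ia -eqi qb eqxx.
  move: nab; rewrite -qb -ia (noncrossingP nc (i := q) (j := i) (k := k) (l := j));
    by rewrite ?qi ?ik ?eqxx ?qb ?kb ?ia ?ja.
rewrite ltnNge leq_eqVlt; apply/negP => /orP[/eqP/val_inj eqj|jq].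
  by move: nab; rewrite -ja eqj qb eqxx.
move: nab; rewrite -kb -ia (noncrossingP nc (i := i) (j := k) (k := j) (l := q));
  by rewrite ?ik ?kj ?eqxx ?qb ?kb ?ia ?ja.
Qed.

(** From labels to partitions: a nesting yields a pattern a, b, a, and the two
    patterns of a crossing give a <= b and b <= a. *)
Lemma monotone_ospE : monotone_osp p = mono_word osp_labels.
Proof.
apply/andP/idP => [[nc]|/forallP mo].
  rewrite all_blocks => /forallP mo; apply/forallP => a; apply/forallP => b.
  apply/implyP => s; have [->//|ab] := eqVneq a b.
  have := mo a; rewrite all_blocks => /forallP/(_ b).
  by rewrite nesting_noncrossing // ab s !index_block /= => /ltnW.
have mo' a b : subseq [:: a; b; a] osp_labels -> (a <= b)%N.
  by move=> s; move: (forallP (mo a) b); rewrite s.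
split.
  rewrite /noncrossing all_blocks; apply/forallP => a; rewrite all_blocks; apply/forallP => b.
  apply/implyP => ab; apply/negP; case/exists_inP => i; rewrite mem_block => /eqP ia.
  case/exists_inP => j; rewrite mem_block => /eqP jb.
  case/exists_inP => k; rewrite mem_block => /eqP ka.
  case/exists_inP => l; rewrite mem_block => /eqP lb /and3P[ij jk kl].
  move: ab; have -> : a = b; last by rewrite eqxx.
  apply: val_inj; apply: anti_leq; rewrite !mo' //; apply/subseq_osp_labelsP.
    by exists j, k, l; rewrite jk kl.
  by exists i, j, k; rewrite ij jk.
rewrite all_blocks; apply/forallP => a; rewrite all_blocks; apply/forallP => b.
apply/implyP => /nesting_subseq/andP[ab /mo']; rewrite !index_block leq_eqVlt.
by rewrite (inj_eq val_inj) (negPf ab).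
Qed.

Lemma inner_blockE b : monotone_osp p ->
  (block b \in inner p) = inner_label osp_labels b.
Proof.
case/andP=> nc _; rewrite mem_filter mem_nth // andbT has_blocks.
by apply: eq_existsb => a; rewrite nesting_noncrossing.
Qed.

Lemma prod_outer_inner (R : comNzRingType) (f g : {set 'I_n} -> R) :
  (\prod_(P <- outer p) f P) * (\prod_(P <- inner p) g P) =
  \prod_(b < size p) (if block b \in inner p then g (block b) else f (block b)).
Proof.
rewrite /outer big_filter [X in _ * X]big_filter big_mkcond [X in _ * X]big_mkcond.
rewrite -big_split /= (big_nth set0) big_mkord; apply: eq_bigr => b _.
rewrite /block [in RHS]mem_filter mem_nth // andbT mem_filter mem_nth // andbT.
by case: (has _ _); rewrite ?mul1r ?mulr1.
Qed.

End OspWords.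

Section CumulantWord.

Variables (K : numFieldType) (A : nuAlgType K).

Lemma cumulant_of_term (phi : {scalar A}) (S : spread_system phi) n (p : osp n) X c :
  (0 < n)%N ->
  multilinear_term setT (fun N => lift_sum S (stacked N) (osp_word p X)) c ->
  cumulant S p X = c.
Proof.
move=> n0 hc; apply: (xget_multilinear_term hc); apply: funext => P; apply: propext.
by split => h N N0; have := h N N0; rewrite phi_dotE.
Qed.

Lemma labels_osp_word n (p : osp n) (X : 'I_n -> A) :
  labels (osp_word p X) = osp_labels p.
Proof. by rewrite /labels -[LHS]map_comp. Qed.

Lemma subword_osp_word n (p : osp n) (X : 'I_n -> A) b :
  subword (osp_word p X) b = [seq X k | k <- enum (block b)].
Proof.
rewrite /subword /osp_word filter_map -map_comp; congr map.
rewrite [in RHS]/enum_mem -enumT; apply: eq_filter => k /=.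
by rewrite mem_block.
Qed.

(** All letters have the same label, so the value is covered by the case of words
    with one label. *)
Lemma cumulant_osp1 (phi : {scalar A}) (S : spread_system phi) n (X : 'I_n -> A) :
  (0 < n)%N -> cumulant S (osp1 n) X = seq_cumulant S [seq X k | k <- enum 'I_n].
Proof.
move=> n0; apply: cumulant_of_term => //.
have s1 : size (osp1 n) = 1%N.
  rewrite /= /rm_empty /= ifT //; apply/set0Pn; exists (Ordinal n0); rewrite inE //.
have t : 'I_(size (osp1 n)) by rewrite s1; exact: ord0.
have allt (b : 'I_(size (osp1 n))) : b = t.
  by move: b t; rewrite s1 => b t; rewrite !ord1.
have -> : [set: 'I_(size (osp1 n))] = [set t].
  by apply/setP => b; rewrite !inE (allt b) eqxx.
have -> : [seq X k | k <- enum 'I_n] = [seq x.2 | x <- osp_word (osp1 n) X].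
  by rewrite -[RHS]map_comp.
apply: lift_sum_one_block.
  rewrite -size_eq0 size_map -lt0n size_map size_enum_ord //.
by apply/allP => b _ /=; rewrite (allt b).
Qed.

Lemma block_cumulantE (phi : {scalar A}) (S : spread_system phi) n (X : 'I_n -> A)
    (P : {set 'I_n}) : P != set0 ->
  block_cumulant S P X = seq_cumulant S [seq X k | k <- enum P].
Proof.
rewrite -card_gt0 => P0; rewrite /block_cumulant cumulant_osp1 //; congr seq_cumulant.
rewrite (map_comp X enum_val); congr map.
have x0 : 'I_n := enum_val (Ordinal P0).
apply: (@eq_from_nth _ x0); rewrite (size_map _ (enum 'I_#|P|)) size_enum_ord -?cardE // => k kP.
rewrite (nth_map (Ordinal kP)) ?size_enum_ord // (nth_ord_enum _ (Ordinal kP)).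
by rewrite (enum_val_nth x0).
Qed.

End CumulantWord.

Theorem proposition3p26 (R : realType) (A : nuAlgType R[i])
    (phi psi : {scalar A}) (CM : cmonotone_system phi psi)
    (M : monotone_system psi) (n : nat) (n_gt0 : (0 < n)%N) (p : osp n)
    (X : 'I_n -> A) :
  cumulant CM p X =
    if monotone_osp p then
      (\prod_(P <- outer p) block_cumulant CM P X) *
      (\prod_(P <- inner p) block_cumulant M P X)
    else 0.
Proof.
have labT : [set b in labels (osp_word p X)] = setT.
  apply/setP => b; rewrite !inE labels_osp_word; have [k <-] := block_witness b.
  by rewrite map_f // mem_enum.
have := lift_sum_term (cmono_rules CM) (mono_rules M) (osp_word p X).
rewrite labT => /(cumulant_of_term n_gt0) ->.
rewrite /mono_product labels_osp_word -monotone_ospE; case: ifP => // mo.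
rewrite prod_outer_inner; apply: eq_big => [b|b _].
  by move/setP: labT => /(_ b); rewrite !inE labels_osp_word.
have b0 : block b != set0.
  have [k kb] := block_witness b; apply/set0Pn; exists k.
  by rewrite mem_block kb.
rewrite inner_blockE // /label_factor labels_osp_word subword_osp_word.
by case: (inner_label _ _); rewrite block_cumulantE.
Qed.
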